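(* Let $f(z)=z+\sum_{n\ge 2}a_nz^n\in\mathcal{BT}_{\mathfrak{B}}$ and let $\Gamma_1,\Gamma_2$ be the logarithmic inverse coefficients of $f$. Then $$|\Gamma_1|\le\frac18\qquad\text{and}\qquad |\Gamma_2|\le\frac{1}{12}.$$ The inequalities are sharp, with equality for $f_1(z)=\int_0^z\sqrt{1+\tanh t}\,dt$ and $f_2(z)=\int_0^z\sqrt{1+\tanh(t^2)}\,dt$, respectively.
   Context: $\mathbb{D}=\{z\in\mathbb{C}:|z|<1\}$. $\mathcal{S}$ is the class of univalent analytic functions $f$ on $\mathbb{D}$ normalized by $f(0)=0$, $f'(0)=1$, i.e. $f(z)=z+\sum_{n\ge2}a_nz^n$. For analytic $g,h$ on $\mathbb{D}$, $g\prec h$ means there is an analytic $\omega:\mathbb{D}\to\mathbb{D}$ with $\omega(0)=0$ and $g=h\circ\omega$. Let $\mathfrak{B}(z)=\sqrt{1+\tanh z}$ (principal branch, $\mathfrak{B}(0)=1$). The class $\mathcal{BT}_{\mathfrak{B}}$ is $\{f\in\mathcal{S}: f'(z)\prec \mathfrak{B}(z)\}$. For $f\in\mathcal{S}$ let $F=f^{-1}$ be its inverse, defined near $0$ (at least on $|w|<1/4$). The logarithmic inverse coefficients $\Gamma_n$ are defined by $\log\frac{f^{-1}(w)}{w}=2\sum_{n\ge1}\Gamma_n w^n$; explicitly $\Gamma_1=-\tfrac12a_2$, $\Gamma_2=-\tfrac12(a_3-\tfrac32a_2^2)$, $\Gamma_3=-\tfrac12(a_4-4a_2a_3+\tfrac{10}{3}a_2^3)$.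 *)

(* Defs.v *)
From HB Require Import structures.
From mathcomp Require Import all_boot all_order all_algebra.
From mathcomp Require Import all_classical all_reals all_analysis.
From mathcomp Require Import complex.
Import Order.TTheory GRing.Theory Num.Theory.
Import numFieldNormedType.Exports.
Import ComplexField.

Set Implicit Arguments.
Unset Strict Implicit.
Unset Printing Implicit Defensive.

Local Open Scope ring_scope.
Local Open Scope complex_scope.
Local Open Scope classical_set_scope.

Section Defs.
Variable R : realType.
Local Notation C := (R[i]).

Definition cexp (z : C) : C :=
  (expR (complex.Re z))%:C * (cos (complex.Im z) +i* sin (complex.Im z)).

Definition ctanh (z : C) : C :=
  (cexp z - cexp (- z)) / (cexp z + cexp (- z)).

(* principal branch of the complex square root (argument in (-pi/2, pi/2]) *)
Definition csqrt (w : C) : C :=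
  let: a +i* b := w in
  let r := Num.sqrt (a ^+ 2 + b ^+ 2) in
  let x := Num.sqrt ((r + a) / 2) in
  let y := Num.sqrt ((r - a) / 2) in
  if b < 0 then x -i* y else x +i* y.

Definition Bfun (z : C) : C := csqrt (1 + ctanh z).

Definition inD (z : C) : Prop := `|z| < 1.

Definition holo_on_D (f : C^o -> C^o) : Prop :=
  forall z : C, inD z -> derivable f z 1.

Definition subordinate (g h : C^o -> C^o) : Prop :=
  exists w : C^o -> C^o,
    [/\ holo_on_D w, w 0 = 0, (forall z, inD z -> inD (w z))
      & (forall z, inD z -> g z = h (w z))].

Definition classS (f : C^o -> C^o) (a : nat -> C) : Prop :=
  [/\ holo_on_D f,
      (forall z : C, inD z ->
         series (fun n => (a n * z ^+ n : C^o)) @ \oo --> f z),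
      a 0%N = 0 /\ a 1%N = 1,
      f 0 = 0 /\ derive1 f 0 = 1
    & (forall z w : C, inD z -> inD w -> f z = f w -> z = w)].

Definition classBT (f : C^o -> C^o) (a : nat -> C) : Prop :=
  classS f a /\ subordinate (derive1 f) (Bfun : C^o -> C^o).

Definition Gamma1 (a : nat -> C) : C := - (a 2%N) / 2.
Definition Gamma2 (a : nat -> C) : C :=
  - (a 3%N - 3 / 2 * a 2%N ^+ 2) / 2.

End Defs.

(* Main.v *)
Require Import Defs.
From HB Require Import structures.
From mathcomp Require Import all_boot all_order all_algebra.
From mathcomp Require Import all_classical all_reals all_analysis.
From mathcomp Require Import complex.
From mathcomp Require Import ring lra.
Import Order.TTheory GRing.Theory Num.Theory.
Import numFieldNormedType.Exports.
Import ComplexField Normc.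
Local Open Scope ring_scope.
Local Open Scope complex_scope.
Local Open Scope classical_set_scope.

Set Implicit Arguments.
Unset Strict Implicit.
Unset Printing Implicit Defensive.

(** The subordination writes f' = B o w with w a Schwarz function, so the bounds follow
    from |w'(0)| <= 1 and |w''(0)/2| <= 1 - |w'(0)|^2, because Gamma_1 = -c_1/8 and
    Gamma_2 = -(c_2 - 13/16 c_1^2)/12 for w = c_1 z + c_2 z^2 + ....

    Cauchy's theory is avoided in two places. The function B is a power series on the
    whole disc: tanh solves T' = 1 - T^2 and B solves B' = B (1 - T)/2, and these
    equations give coefficient recursions whose solutions are bounded by 1. And w' is
    differentiable because B' = B - B^3/2 yields w' = f''/(f' - f'^3/2); hence the maximum
    principle, and from it the Schwarz-Pick inequality at 0, can be proved by an elementary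
    second-order expansion at an interior maximum. *)

(** A Schwarz function comes with one complex derivative only. The coefficients [a] in [classS]
    supply the missing regularity: they make f' a power series, and this regularity passes to w
    because B' = B (2 - B^2) / 2 has no zero on the disc. For that reason the construction of B also
    records Re B > 0 and B^2 <> 2. The quotient w / z and the Schwarz-Pick quotient are known near
    the origin only through bounds, so the maximum principle has to work on the punctured disc.

    The constant 13/16 is 1/4 + 9/16: the part 1/4 comes from the coefficient -1/8 of z^2 in B, the
    part 9/16 from 3/2 a_2^2 in Gamma_2. Since 13/16 < 1, the triangle inequality suffices: |c_2| +
    13/16 |c_1|^2 <= 1 - 3/16 |c_1|^2 <= 1. Equality forces c_1 = 0 and |c_2| = 1, as for w = z^2,
    whereas w = z is extremal for Gamma_1. Positivity of Re B also makes the primitives of B(z) and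
    B(z^2) univalent, which places the extremal functions in the class. *)

Section Modulus.
Variable R : realType.
Implicit Types z w : R[i].

Lemma normrc z : `|z| = (normc z)%:C.
Proof. by []. Qed.

Lemma normcD z w : normc (z + w) <= normc z + normc w.
Proof. exact: (@le_normcD R z w). Qed.

Lemma normc_opp z : normc (- z) = normc z.
Proof. exact: (@normcN R z). Qed.

Lemma normcB z w : normc (z - w) <= normc z + normc w.
Proof. by rewrite -(normc_opp w) normcD. Qed.

Lemma normc_ge0 z : 0 <= normc z.
Proof. by case: z => a b /=; rewrite sqrtr_ge0. Qed.

Lemma normcX z n : normc (z ^+ n) = normc z ^+ n.
Proof. by elim: n => [|n IH]; rewrite ?expr0 ?normc1// !exprS normcM IH. Qed.

Lemma normc_real (x : R) : normc x%:C = `|x|.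
Proof. by rewrite /= expr0n /= addr0 sqrtr_sqr. Qed.

Lemma normc_nat n : normc (n%:R : R[i]) = n%:R.
Proof. by rewrite -(rmorph_nat (real_complex R)) normc_real ger0_norm. Qed.

Lemma normc_eq0 z : (normc z == 0) = (z == 0).
Proof. by apply/eqP/eqP => [/eq0_normc //|->]; rewrite normc0. Qed.

Lemma normc_gt0 z : (0 < normc z) = (z != 0).
Proof. by rewrite lt_def normc_ge0 andbT normc_eq0. Qed.

Lemma inDE z : inD z <-> normc z < 1.
Proof. by rewrite /inD normrc -(ltcR (normc z) 1). Qed.

Lemma Re_le_normc z : `|complex.Re z| <= normc z.
Proof.
by case: z => a b /=; rewrite -sqrtr_sqr ler_sqrt ?lerDl ?addr_ge0 ?sqr_ge0.
Qed.

Lemma Im_le_normc z : `|complex.Im z| <= normc z.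
Proof.
by case: z => a b /=; rewrite -sqrtr_sqr ler_sqrt ?lerDr ?addr_ge0 ?sqr_ge0.
Qed.

Lemma normc_le_ReIm z : normc z <= `|complex.Re z| + `|complex.Im z|.
Proof.
case: z => a b /=; rewrite -(ger0_norm (addr_ge0 (normr_ge0 a) (normr_ge0 b))).
rewrite -sqrtr_sqr ler_sqrt ?sqr_ge0// sqrrD !real_normK ?num_real// lerD2r lerDl.
by rewrite mulrn_wge0 ?mulr_ge0.
Qed.

Lemma normc_sqr z : normc z ^+ 2 = complex.Re z ^+ 2 + complex.Im z ^+ 2.
Proof. by case: z => a b /=; rewrite sqr_sqrtr ?addr_ge0 ?sqr_ge0. Qed.

Lemma ReM z w : complex.Re (z * w) =
  complex.Re z * complex.Re w - complex.Im z * complex.Im w.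
Proof. by case: z w => a b []. Qed.

Lemma ImM z w : complex.Im (z * w) =
  complex.Re z * complex.Im w + complex.Im z * complex.Re w.
Proof. by case: z w => a b []. Qed.

Lemma ReD z w : complex.Re (z + w) = complex.Re z + complex.Re w.
Proof. by case: z w => a b []. Qed.

Lemma ImD z w : complex.Im (z + w) = complex.Im z + complex.Im w.
Proof. by case: z w => a b []. Qed.

Lemma ReN z : complex.Re (- z) = - complex.Re z.
Proof. by case: z. Qed.

Lemma ImN z : complex.Im (- z) = - complex.Im z.
Proof. by case: z. Qed.

Lemma complex_eqP z w : complex.Re z = complex.Re w ->
  complex.Im z = complex.Im w -> z = w.
Proof. by case: z w => a b [c d] /= -> ->. Qed.

(** A positive element of [R[i]] has zero imaginary part, so the complex radii of the topology
    reduce to real ones. *)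
Lemma normc_nbhs (z : R[i]^o) (P : R[i] -> Prop) :
  (\forall x \near z, P x) <->
  exists2 d : R, 0 < d & forall x, normc (z - x) < d -> P x.
Proof.
split=> [/nbhs_normP[d /= d0 dP]|[d d0 dP]]; last first.
  apply/nbhs_normP; exists d%:C => /=; first by rewrite (ltcR 0).
  by move=> y /=; rewrite normrc ltcR; apply: dP.
exists (complex.Re d); first by move: d0; rewrite ltcE => /andP[].
move=> x xd; apply: dP => /=; rewrite ltcE /=.
by move: d0; rewrite ltcE => /andP[/= /eqP -> _]; rewrite eqxx.
Qed.

End Modulus.

(** * Complex derivatives in epsilon-delta form *)

Section Cderiv.
Variable R : realType.
Local Notation C := (R[i]).
Implicit Types (f g : C -> C) (z : C).

(** The scalars are complex, so the increments in direction 1 run over all of C: this is complex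
    differentiability. *)
Definition cderiv f z d := is_derive (z : C^o) (1 : C^o) (f : C^o -> C^o) d.

Lemma cderivP f z d : cderiv f z d <->
  forall e : R, 0 < e -> exists2 r : R, 0 < r &
    forall h, normc h < r -> normc (f (z + h) - f z - d * h) <= e * normc h.
Proof.
split=> [df e e0|H].
  have /derivable_nbhsP/eqaddoP/(_ e%:C) := @ex_derive _ _ _ _ _ _ _ df.
  rewrite (ltcR 0) => /(_ e0)/normc_nbhs[r r0 rP]; exists r => // h hr.
  have := rP h; rewrite sub0r normc_opp => /(_ hr).
  rewrite /= !fctE /= !normrc -(rmorphM (real_complex R)) lecR.
  rewrite (@derive_val _ _ _ _ _ _ _ df).
  rewrite [h%:A]mulr1 [_ *: d]mulrC opprD addrA.
  by rewrite [h + z]addrC.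
have df : (h^-1 *: (((f : C^o -> C^o) \o shift (z : C^o)) (h *: (1 : C^o)) - f z))
    @[h --> (0 : C^o)^'] --> (d : C^o).
  apply/cvgrPdist_le => e; rewrite ltcE /= => /andP[/eqP ei e0].
  have [r r0 rP] := H _ e0.
  rewrite near_withinE; apply/normc_nbhs; exists r => // h.
  rewrite sub0r normc_opp => hr h0.
  rewrite [h%:A]mulr1 [h + z]addrC normrc lecE /= -ei eqxx /=.
  have -> : d - h^-1 *: (f (z + h) - f z) = - h^-1 * (f (z + h) - f z - d * h).
    set X := f (z + h) - f z; rewrite (_ : h^-1 *: X = h^-1 * X) //.
    have {1}-> : d = h^-1 * (d * h) by rewrite mulrCA mulVf ?mulr1.
    ring.
  rewrite normcM normc_opp normcV ler_pdivrMl ?normc_gt0// [leRHS]mulrC; exact: rP.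
by apply: DeriveDef; [exact: cvgP df | apply: cvg_lim].
Qed.

Lemma cderiv_unique f z d d' : cderiv f z d -> cderiv f z d' -> d = d'.
Proof. by move=> [_ <-] [_ <-]. Qed.

Lemma cderiv_derivable f z : derivable (f : C^o -> C^o) z 1 ->
  cderiv f z (derive1 (f : C^o -> C^o) z).
Proof. by move=> df; rewrite derive1E; apply: derivableP. Qed.

Lemma derive1_cderiv f z d : cderiv f z d -> derive1 (f : C^o -> C^o) z = d.
Proof. by move=> [_ <-]; rewrite derive1E. Qed.

Lemma cderiv_eq f z d d' : cderiv f z d -> d = d' -> cderiv f z d'.
Proof. by move=> ? <-. Qed.

Lemma cderiv_near f g z d r : 0 < r ->
  (forall h, normc h < r -> f (z + h) = g (z + h)) -> cderiv f z d -> cderiv g z d.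
Proof.
move=> r0 fg /cderivP df; apply/cderivP => e /df[s s0 sP].
exists (Num.min s r); first by rewrite lt_min s0.
move=> h; rewrite lt_min => /andP[hs hr].
by rewrite -fg // -[in g z](addr0 z) -fg ?normc0 // addr0; apply: sP.
Qed.

Lemma cderiv_cst c z : cderiv (fun=> c) z 0.
Proof. exact: is_derive_cst. Qed.

Lemma cderiv_id z : cderiv id z 1.
Proof. exact: is_derive_id. Qed.

Lemma cderivD f g z d d' : cderiv f z d -> cderiv g z d' ->
  cderiv (fun x => f x + g x) z (d + d').
Proof. by move=> df dg; apply: (@is_deriveD _ _ _ (f : C^o -> C^o) (g : C^o -> C^o)). Qed.

Lemma cderivN f z d : cderiv f z d -> cderiv (fun x => - f x) z (- d).
Proof. by move=> df; apply: (@is_deriveN _ _ _ (f : C^o -> C^o)). Qed.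

Lemma cderivB f g z d d' : cderiv f z d -> cderiv g z d' ->
  cderiv (fun x => f x - g x) z (d - d').
Proof. by move=> df dg; apply/cderivD/cderivN. Qed.

Lemma cderivM f g z d d' : cderiv f z d -> cderiv g z d' ->
  cderiv (fun x => f x * g x) z (f z * d' + g z * d).
Proof. by move=> df dg; apply: (@is_deriveM _ _ (f : C^o -> C^o) (g : C^o -> C^o)). Qed.

Lemma cderivV f z d : f z != 0 -> cderiv f z d ->
  cderiv (fun x => (f x)^-1) z (- d / f z ^+ 2).
Proof.
move=> f0 [df <-]; apply: (DeriveDef (derivableV f0 df)).
by rewrite (@deriveV _ _ (f : C^o -> C^o)) // [_ *: _]mulrC mulrN mulNr.
Qed.

Lemma cderiv_bound f z d : cderiv f z d -> exists2 r : R, 0 < r &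
  forall h, normc h < r -> normc (f (z + h) - f z) <= (normc d + 1) * normc h.
Proof.
move=> /cderivP/(_ 1 ltr01)[r r0 rP]; exists r => // h /rP.
have := normcD (f (z + h) - f z - d * h) (d * h).
by rewrite subrK mul1r normcM mulrDl mul1r; lra.
Qed.

Lemma cderiv_cont f z d : cderiv f z d -> forall e : R, 0 < e ->
  exists2 r : R, 0 < r & forall h, normc h < r -> normc (f (z + h) - f z) < e.
Proof.
move=> /cderiv_bound[r r0 rP] e e0.
have K0 : 0 < normc d + 1 by rewrite ltr_wpDl ?normc_ge0.
exists (Num.min r (e / (normc d + 1))); first by rewrite lt_min r0 divr_gt0.
move=> h; rewrite lt_min => /andP[/rP hr]; rewrite ltr_pdivlMr // mulrC.
exact: le_lt_trans.
Qed.

Lemma cderiv_comp f g z d d' : cderiv f z d -> cderiv g (f z) d' ->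
  cderiv (fun x => g (f x)) z (d' * d).
Proof.
move=> df dg; have [r1 r10 r1P] := cderiv_bound df.
apply/cderivP => e e0; set K := normc d + 1 in r1P.
have K0 : 0 < K by rewrite ltr_wpDl ?normc_ge0.
have K'0 : 0 < normc d' + 1 by rewrite ltr_wpDl ?normc_ge0.
have /cderivP/(_ (e / 2 / K))[|r2 r20 r2P] := dg; first by rewrite !divr_gt0.
have /cderivP/(_ (e / 2 / (normc d' + 1)))[|r3 r30 r3P] := df.
  by rewrite !divr_gt0.
exists (Num.min r1 (Num.min (r2 / K) r3)); first by rewrite !lt_min r10 r30 divr_gt0.
move=> h; rewrite !lt_min => /and3P[/r1P h1 h2 /r3P h3].
have := r2 ; have := r2P (f (z + h) - f z).
rewrite [X in g X]addrC subrK => /(_ _) h4 _.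
have {h4} h4 : normc (g (f (z + h)) - g (f z) - d' * (f (z + h) - f z))
    <= e / 2 / K * normc (f (z + h) - f z).
  apply: h4; apply: le_lt_trans h1 _; rewrite mulrC -ltr_pdivlMr //.
have -> : g (f (z + h)) - g (f z) - d' * d * h =
  (g (f (z + h)) - g (f z) - d' * (f (z + h) - f z)) +
  d' * (f (z + h) - f z - d * h) by ring.
apply: le_trans (normcD _ _) _; rewrite normcM.
have h5 : normc (g (f (z + h)) - g (f z) - d' * (f (z + h) - f z)) <= e / 2 * normc h.
  apply: le_trans h4 _; rewrite -[e / 2 / K * _]mulrA.
  by rewrite ler_wpM2l ?divr_ge0 ?(ltW e0) // ler_pdivrMl.
have h6 : normc d' * normc (f (z + h) - f z - d * h) <= e / 2 * normc h.
  apply: le_trans (_ : (normc d' + 1) * normc (f (z + h) - f z - d * h) <= _).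
    by rewrite ler_wpM2r ?normc_ge0 // lerDl.
  apply: le_trans (ler_wpM2l (ltW K'0) h3) _.
  by rewrite mulrA mulrCA divff ?mulr1 ?gt_eqF.
lra.
Qed.

End Cderiv.

(** * Mean value inequality and second-order expansion along segments *)

Section MeanValue.
Variable R : realType.
Local Notation C := (R[i]).
Implicit Types (f g : C -> C) (z v : C).

Lemma is_derive_real (f : R -> R) (x d : R) :
  (forall e : R, 0 < e -> exists2 r : R, 0 < r &
    forall h, `|h| < r -> `|f (x + h) - f x - d * h| <= e * `|h|) ->
  is_derive x 1 f d.
Proof.
move=> H.
have df : (h^-1 *: ((f \o shift x) (h *: 1) - f x)) @[h --> 0^'] --> d.
  apply/cvgrPdist_le => e e0.
  have [r r0 rP] := H _ e0.
  rewrite near_withinE; apply/nbhs_normP; exists r => // h /=.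
  rewrite sub0r normrN => hr h0.
  rewrite [h%:A]mulr1 [h + x]addrC.
  set X := f (x + h) - f x; rewrite (_ : h^-1 *: X = h^-1 * X) //.
  have {1}-> : d = h^-1 * (d * h) by rewrite mulrCA mulVf ?mulr1.
  rewrite -mulrBr normrM normfV ler_pdivrMl ?normr_gt0// [leRHS]mulrC distrC.
  exact: rP.
by apply: DeriveDef; [exact: cvgP df | apply: cvg_lim].
Qed.

(** The real mean value theorem concerns real functions; the weight [c] gives access to every
    real-linear coordinate of [f] along a line. *)
Lemma cderiv_line f z v (d : C) (x : R) (c : C) : cderiv f (z + x%:C * v) d ->
  is_derive x 1 (fun t : R => complex.Re (c * f (z + t%:C * v)))
    (complex.Re (c * (d * v))).
Proof.
move=> /cderivP df; apply: is_derive_real => e e0.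
pose K := (normc c + 1) * (normc v + 1).
have K0 : 0 < K by rewrite mulr_gt0 // ltr_wpDl ?normc_ge0.
have v0 : 0 < normc v + 1 by rewrite ltr_wpDl ?normc_ge0.
have [|r r0 rP] := df (e / K); first by rewrite divr_gt0.
exists (r / (normc v + 1)); first by rewrite divr_gt0.
move=> h; rewrite ltr_pdivlMr // => hr.
have hv : normc (h%:C * v) <= `|h| * (normc v + 1).
  by rewrite normcM normc_real ler_wpM2l // lerDl.
have := rP _ (le_lt_trans hv hr).
rewrite -[in z + x%:C * v + _]addrA -mulrDl -rmorphD /= => H.
have -> : complex.Re (c * f (z + (x + h)%:C * v)) - complex.Re (c * f (z + x%:C * v))
    - complex.Re (c * (d * v)) * h =
  complex.Re (c * (f (z + (x + h)%:C * v) - f (z + x%:C * v) - d * (h%:C * v))).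
  by rewrite !(ReM, ImM, ReD, ImD, ReN, ImN) /=; ring.
apply: le_trans (Re_le_normc _) _; rewrite normcM.
apply: le_trans (_ : (normc c + 1) * (e / K * (`|h| * (normc v + 1))) <= _).
  apply: ler_pM; rewrite ?normc_ge0 ?lerDl //.
  by apply: le_trans H _; rewrite ler_wpM2l // divr_ge0 // ltW.
rewrite /K le_eqVlt; apply/orP; left; apply/eqP; field.
by rewrite !gt_eqF // ltr_wpDl ?normc_ge0.
Qed.

Lemma cderiv_MVT f (f' : C -> C) z v (c : C) :
  (forall t : R, 0 <= t <= 1 -> cderiv f (z + t%:C * v) (f' (z + t%:C * v))) ->
  exists2 t : R, 0 <= t <= 1 & complex.Re (c * (f (z + v) - f z)) =
    complex.Re (c * (f' (z + t%:C * v) * v)).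
Proof.
move=> df.
pose F (t : R) := complex.Re (c * f (z + t%:C * v)).
pose F' (t : R) := complex.Re (c * (f' (z + t%:C * v) * v)).
have dF (t : R) : 0 <= t <= 1 -> is_derive t 1 F (F' t).
  by move=> t01; apply: cderiv_line; apply: df.
have [| |t] := @MVT _ F F' 0 1 ltr01.
- by move=> x; rewrite in_itv /= => /andP[/ltW x0 /ltW x1]; apply: dF; rewrite x0.
- apply: derivable_within_continuous => x; rewrite in_itv /= => x01.
  by case: (dF x x01).
rewrite in_itv /= => /andP[/ltW t0 /ltW t1]; rewrite subr0 mulr1 => E.
exists t; first by rewrite t0.
move: E; rewrite /F /F' rmorph1 rmorph0 mul1r mul0r addr0 => <-.
by rewrite mulrBr ReD ReN.
Qed.

Lemma conjc_normc z : z^* * z = (normc z ^+ 2)%:C.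
Proof. by apply: complex_eqP; rewrite /= ?normc_sqr; case: z => a b /=; ring. Qed.

Lemma normc_conjc z : normc z^* = normc z.
Proof. by case: z => a b /=; rewrite sqrrN. Qed.

Lemma cderiv_MVI f (f' : C -> C) z v (K : R) :
  (forall t : R, 0 <= t <= 1 -> cderiv f (z + t%:C * v) (f' (z + t%:C * v))) ->
  (forall t : R, 0 <= t <= 1 -> normc (f' (z + t%:C * v)) <= K) ->
  normc (f (z + v) - f z) <= K * normc v.
Proof.
(* With the conjugate increment as weight, the left side of the mean value identity becomes the
   squared modulus of the increment; one factor is cancelled at the end. *)
move=> df fK; have [t t01] := cderiv_MVT (f (z + v) - f z)^* df.
rewrite conjc_normc /= => E.
have : normc (f (z + v) - f z) ^+ 2 <= normc (f (z + v) - f z) * (K * normc v).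
  rewrite E; apply: le_trans (ler_norm _) _; apply: le_trans (Re_le_normc _) _.
  rewrite !normcM normc_conjc ler_wpM2l ?normc_ge0 //.
  by rewrite ler_wpM2r ?normc_ge0 ?fK.
have := normc_ge0 (f (z + v) - f z); rewrite le_eqVlt => /orP[/eqP <- _|h].
  rewrite mulr_ge0 ?normc_ge0 //; apply: le_trans (fK 0 _); rewrite ?normc_ge0 //.
  by rewrite lexx ler01.
by rewrite expr2 ler_pM2l.
Qed.

Lemma normc_segment z v (t r : R) : 0 <= t <= 1 -> normc z < r -> normc (z + v) < r ->
  normc (z + t%:C * v) < r.
Proof.
move=> /andP[t0 t1] zr vr.
have -> : z + t%:C * v = (1 - t)%:C * z + t%:C * (z + v).
  by rewrite rmorphB rmorph1; ring.
apply: le_lt_trans (normcD _ _) _; rewrite !normcM !normc_real !ger0_norm ?subr_ge0 //.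
have [->|tn] := eqVneq t 0; first by rewrite subr0 mul1r mul0r addr0.
have {}t0 : 0 < t by rewrite lt_neqAle eq_sym tn.
nra.
Qed.

Lemma cderiv0_cst f : (forall z, normc z < 1 -> cderiv f z 0) ->
  forall z, normc z < 1 -> f z = f 0.
Proof.
move=> df z z1.
have seg (t : R) : 0 <= t <= 1 -> normc (0 + t%:C * z) < 1.
  by move=> t01; apply: normc_segment; rewrite ?add0r ?normc0 ?ltr01.
have := @cderiv_MVI f (fun=> 0) 0 z 0 (fun t t01 => df _ (seg t t01)).
rewrite add0r mul0r normc0 => /(_ (fun _ _ => lexx _)) H.
apply/eqP; rewrite -subr_eq0 -normc_eq0 eq_le H; exact: normc_ge0.
Qed.

(** The remainder [F] has as derivative the first-order remainder [F'] of [g1] at [z], at most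
    [e * normc h] on the segment; the mean value inequality supplies the second factor [normc h].
    Differentiability of [g1] enters at the single point [z]. *)
Lemma cderiv_taylor2 g (g1 : C -> C) z (g2 : C) (r : R) : 0 < r ->
  (forall h, normc h < r -> cderiv g (z + h) (g1 (z + h))) -> cderiv g1 z g2 ->
  forall e : R, 0 < e -> exists2 s : R, 0 < s & forall h, normc h < s ->
    normc (g (z + h) - g z - g1 z * h - g2 / 2 * h ^+ 2) <= e * normc h ^+ 2.
Proof.
move=> r0 dg /cderivP dg1 e e0; have [s s0 sP] := dg1 e e0.
exists (Num.min r s) => [|h]; rewrite lt_min ?r0 // => /andP[hr hs].
pose F x := g (z + x) - g1 z * x - g2 / 2 * x ^+ 2.
pose F' x := g1 (z + x) - g1 z - g2 * x.
have seg (t q : R) : 0 <= t <= 1 -> 0 < q -> normc h < q -> normc (0 + t%:C * h) < q.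
  by move=> t01 q0 hq; apply: normc_segment; rewrite ?add0r ?normc0.
have dF (t : R) : 0 <= t <= 1 -> cderiv F (0 + t%:C * h) (F' (0 + t%:C * h)).
  move=> t01; have := seg t r t01 r0 hr; set x := 0 + _ => xr.
  rewrite /F; apply: cderiv_eq.
    apply: cderivB; [apply: cderivB|].
    - apply: (@cderiv_comp _ (fun x => z + x) g); first last.
        exact: dg.
      exact: cderivD (cderiv_cst _ _) (cderiv_id _).
    - exact: cderivM (cderiv_cst _ _) (cderiv_id _).
    - exact: cderivM (cderiv_cst _ _) (cderivM (cderiv_id _) (cderiv_id _)).
  by rewrite /F' add0r !mulr1 !mulr0 !addr0; field.
have := @cderiv_MVI F F' 0 h (e * normc h) dF.
rewrite /F add0r addr0 mulr0 expr0n /= mulr0 !subr0 -[e * _ * _]mulrA -expr2 => H.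
rewrite (_ : _ - _ = g (z + h) - g1 z * h - g2 / 2 * h ^+ 2 - g z); last ring.
apply: H => t t01; apply: le_trans (sP _ (seg t s t01 s0 hs)) _.
rewrite ler_wpM2l ?(ltW e0) // add0r normcM normc_real ger0_norm; last by case/andP: t01.
by rewrite ler_piMl ?normc_ge0 //; case/andP: t01.
Qed.

End MeanValue.

(** * Power series on the unit disc and termwise differentiation *)

Section PowerSeries.
Variable R : realType.
Local Notation C := (R[i]).
Implicit Types (a b : nat -> C) (z : C).

Lemma cvg_normcP (u : nat -> C^o) (l : C^o) : u n @[n --> \oo] --> l <->
  forall e : R, 0 < e -> exists N, forall n, (N <= n)%N -> normc (l - u n) < e.
Proof.
split=> [/cvgrPdist_lt ul e e0|H].
  have := ul e%:C; rewrite (ltcR 0) => /(_ e0)[N _ NP]; exists N => n Nn.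
  by have := NP n Nn; rewrite normrc ltcR.
apply/cvgrPdist_lt => e; rewrite ltcE /= => /andP[/eqP ei e0].
have [N NP] := H _ e0; exists N => // n Nn /=.
by rewrite normrc ltcE /= ei eqxx; apply: NP.
Qed.

Lemma cvg_normc_le (u : nat -> C^o) (l : C^o) (K : R) :
  u n @[n --> \oo] --> l -> (forall n, normc (u n) <= K) -> normc l <= K.
Proof.
move=> /cvg_normcP ul uK; apply/ler_addgt0Pr => e e0.
have [N NP] := ul e e0; have := normcD (l - u N) (u N).
have := uK N; have := NP N (leqnn N); rewrite subrK; lra.
Qed.

Lemma cvg_complex (u : nat -> C^o) (x y : R) :
  complex.Re (u n) @[n --> \oo] --> x -> complex.Im (u n) @[n --> \oo] --> y ->
  u n @[n --> \oo] --> ((x +i* y : C) : C^o).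
Proof.
move=> /cvgrPdist_lt ux /cvgrPdist_lt uy; apply/cvg_normcP => e e0.
have e20 : 0 < e / 2 by rewrite divr_gt0.
have [[N1 _ N1P] [N2 _ N2P]] := (ux _ e20, uy _ e20).
exists (maxn N1 N2) => n; rewrite geq_max => /andP[n1 n2].
apply: le_lt_trans (normc_le_ReIm _) _.
rewrite ReD ReN ImD ImN /=.
have := N1P n n1; have := N2P n n2; rewrite /=; lra.
Qed.

Lemma cvg_expr0 (q : R) : 0 <= q < 1 -> forall e : R, 0 < e ->
  exists N, forall n, (N <= n)%N -> q ^+ n < e.
Proof.
move=> /andP[q0 q1] e e0.
have := @cvg_geometric R 1 q; rewrite ger0_norm // => /(_ q1).
move=> /cvgrPdist_lt/(_ e e0)[N _ NP]; exists N => n /NP /=.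
by rewrite mul1r sub0r normrN ger0_norm ?exprn_ge0.
Qed.

(** The left side is one term of the binomial expansion. The inequality trades a factor [n.+1] for a
    slightly larger radius, which is how derived series and Cauchy products are controlled. *)
Lemma expr_add_ge (q x : R) n : 0 <= q -> 0 <= x ->
  n.+1%:R * q ^+ n * x <= (q + x) ^+ n.+1.
Proof.
move=> q0 x0; apply: le_trans (_ : q ^+ n.+1 + n.+1%:R * q ^+ n * x <= _).
  by rewrite lerDr exprn_ge0.
elim: n => [|n IH]; first by rewrite !expr1 expr0 !mul1r.
rewrite [in leRHS]exprS; apply: le_trans (ler_wpM2l (addr_ge0 q0 x0) IH).
rewrite -[n.+2%:R]natr1 -subr_ge0 !exprS.
rewrite (_ : _ - _ = n.+1%:R * q ^+ n * x ^+ 2); last by ring.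
by rewrite !mulr_ge0 ?exprn_ge0.
Qed.

Definition pseries a z : nat -> C^o := series (fun n => (a n * z ^+ n : C^o)).

Lemma pseriesE a z n : pseries a z n = \sum_(k < n) a k * z ^+ k.
Proof. by rewrite /pseries seriesEord. Qed.

(** Radius of convergence at least 1, encoded by bounded terms at every smaller radius: this form
    passes to the derived series and gives absolute convergence by comparison with a geometric
    series. *)
Definition rad_ge1 a := forall q : R, 0 <= q < 1 ->
  exists K : R, forall n, normc (a n) * q ^+ n <= K.

(** The limits of real and imaginary parts are taken separately, so that convergence comes from the
    real comparison test; the value is meaningful only where the series converges. *)
Definition ps a z : C :=
  limn (fun n => complex.Re (pseries a z n)) +i*
  limn (fun n => complex.Im (pseries a z n)).

Definition dseq a n : C := n.+1%:R * a n.+1.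

Lemma rad_ge1_bounded a (K : R) : (forall n, normc (a n) <= K) -> rad_ge1 a.
Proof.
move=> aK q /andP[q0 q1]; exists K => n; apply: le_trans (aK n).
by rewrite ler_piMr ?normc_ge0 // exprn_ile1 // ltW.
Qed.

Lemma rad_ge1_dseq a : rad_ge1 a -> rad_ge1 (dseq a).
Proof.
move=> ra q /andP[q0 q1]; pose x := (1 - q) / 2.
have x0 : 0 < x by rewrite divr_gt0 // subr_gt0.
have [|K KP] := ra (q + x); first by rewrite /x; lra.
exists (K / x) => n; rewrite ler_pdivlMr // /dseq normcM normc_nat.
apply: le_trans (KP n.+1).
rewrite [leLHS](_ : _ = normc (a n.+1) * (n.+1%:R * q ^+ n * x)); last by ring.
by rewrite ler_wpM2l ?normc_ge0 // expr_add_ge // ltW.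
Qed.

Lemma rad_ge1_abs_summable a (q : R) : rad_ge1 a -> 0 <= q < 1 ->
  exists K : R, forall n, \sum_(k < n) normc (a k) * q ^+ k <= K.
Proof.
move=> ra /andP[q0 q1]; pose r := (1 + q) / 2.
have r0 : 0 < r by rewrite /r; lra.
have [|K KP] := ra r; first by rewrite /r; lra.
pose s := q / r; have s0 : 0 <= s by rewrite divr_ge0 // ltW.
have s1 : s < 1 by rewrite ltr_pdivrMr // mul1r /r; lra.
have K0 : 0 <= K by apply: le_trans (KP 0%N); rewrite mulr_ge0 ?normc_ge0.
exists (K / (1 - s)) => n; rewrite ler_pdivlMr ?subr_gt0 //.
apply: le_trans (_ : K * (1 - s ^+ n) <= _); last first.
  by rewrite ler_piMr // gerBl exprn_ge0.
rewrite -[1 in leRHS](expr1n _ n) subrXX [leLHS]mulrC mulrCA ler_wpM2l ?subr_ge0 ?(ltW s1) //.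
rewrite mulr_sumr; apply: ler_sum => i _; rewrite expr1n mul1r.
apply: le_trans (ler_wpM2r _ (KP i)); last by rewrite exprn_ge0.
by rewrite -mulrA -exprMn [r * s]mulrC /s divrK // unitfE gt_eqF.
Qed.

Lemma pseries_cvg a z : rad_ge1 a -> normc z < 1 ->
  pseries a z n @[n --> \oo] --> (ps a z : C^o).
Proof.
move=> ra z1; have [|K KP] := @rad_ge1_abs_summable a (normc z) ra.
  by rewrite normc_ge0.
have cv : cvgn (series (fun n => normc (a n) * normc z ^+ n)).
  apply: nondecreasing_is_cvgn.
    apply/nondecreasing_seqP => n; rewrite !seriesEnat /= big_nat_recr //= lerDl.
    by rewrite mulr_ge0 ?exprn_ge0 ?normc_ge0.
  by exists K => _ [n _ <-]; rewrite seriesEord; apply: KP.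
have cvt (g : C -> R) : (forall w, `|g w| <= normc w) ->
    (forall n, g (pseries a z n) = series (fun n => g (a n * z ^+ n)) n) ->
    g (pseries a z n) @[n --> \oo] --> limn (fun n => g (pseries a z n)).
  move=> gle gs; rewrite (_ : (fun n => g _) = series (fun n => g (a n * z ^+ n))).
    apply: normed_cvg; apply: series_le_cvg cv => n /=.
    - exact: normr_ge0.
    - by rewrite mulr_ge0 ?exprn_ge0 ?normc_ge0.
    - by apply: le_trans (gle _) _; rewrite normcM normcX.
  by apply/funext.
apply: cvg_complex; apply: cvt => [w|n]; rewrite ?Re_le_normc ?Im_le_normc //.
  by rewrite /pseries !seriesEord; apply: (big_morph _ (@ReD R)).
by rewrite /pseries !seriesEord; apply: (big_morph _ (@ImD R)).
Qed.

Lemma pseries_unique a z l : rad_ge1 a -> normc z < 1 ->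
  pseries a z n @[n --> \oo] --> (l : C^o) -> ps a z = l.
Proof. by move=> ra z1 cv; apply: cvg_unique (pseries_cvg ra z1) cv. Qed.

Lemma ps0 a : rad_ge1 a -> ps a 0 = a 0%N.
Proof.
move=> ra; apply: pseries_unique; rewrite ?normc0 //.
apply/cvg_normcP => e e0; exists 1%N => -[//|n] _.
rewrite pseriesE big_ord_recl big1 => [|i _]; last by rewrite exprS mul0r mulr0.
by rewrite expr0 mulr1 addr0 subrr normc0.
Qed.

(** Serves the coefficients in [classS], of which only convergence on the disc is known. A term is
    the difference of two consecutive partial sums, hence eventually below 2; the finite sum bounds
    the earlier terms. *)
Lemma pseries_rad_ge1 a : (forall z, normc z < 1 -> exists l : C^o,
  pseries a z n @[n --> \oo] --> l) -> rad_ge1 a.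
Proof.
move=> cv q /andP[q0 q1].
have [|l /cvg_normcP/(_ 1 ltr01)[N NP]] := cv q%:C.
  by rewrite normc_real ger0_norm.
have S0 (k : nat) : 0 <= normc (a k) * q ^+ k by rewrite mulr_ge0 ?normc_ge0 ?exprn_ge0.
exists (2 + \sum_(k < N) normc (a k) * q ^+ k) => n.
have [nN|Nn] := ltnP n N.
  rewrite (bigD1 (Ordinal nN)) //= addrCA lerDl addr_ge0 //.
  by apply: sumr_ge0 => i _.
apply: le_trans (_ : 2 <= _); last by rewrite lerDl sumr_ge0.
have -> : normc (a n) * q ^+ n = normc (a n * q%:C ^+ n).
  by rewrite normcM normcX normc_real ger0_norm.
have -> : a n * q%:C ^+ n = pseries a q%:C n.+1 - pseries a q%:C n.
  by rewrite !pseriesE big_ord_recr /=; ring.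
have := normcB (l - pseries a q%:C n) (l - pseries a q%:C n.+1).
rewrite (_ : l - _ - (l - _) = pseries a q%:C n.+1 - pseries a q%:C n); last by ring.
have := NP n Nn; have := NP n.+1 (leqW Nn); lra.
Qed.

(** The constant bounds the second derivative of x^(n+2) on the disc of radius [q]. Weighted by the
    modulus of a_(n+2) and summed, it becomes the series of [dseq (dseq a)] at [q]. *)
Lemma normc_expr_taylor (z h : C) (q : R) n : normc z <= q -> normc (z + h) <= q ->
  normc ((z + h) ^+ n.+2 - z ^+ n.+2 - n.+2%:R * z ^+ n.+1 * h) <=
    n.+2%:R * n.+1%:R * q ^+ n * normc h ^+ 2.
Proof.
move=> zq zhq; have q0 : 0 <= q := le_trans (normc_ge0 z) zq.
elim: n => [|n IH].
  rewrite (_ : _ - _ - _ = h ^+ 2); last by ring.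
  by rewrite normcX expr0 !mulr1 ler_peMl ?exprn_ge0 ?normc_ge0 // ler1n.
rewrite (_ : _ - _ = (z + h) * ((z + h) ^+ n.+2 - z ^+ n.+2 - n.+2%:R * z ^+ n.+1 * h)
   + n.+2%:R * z ^+ n.+1 * h ^+ 2); last first.
  by rewrite -[n.+3%:R]natr1 !exprS; ring.
apply: le_trans (normcD _ _) _; rewrite !normcM !normcX normc_nat.
apply: le_trans (_ : q * (n.+2%:R * n.+1%:R * q ^+ n * normc h ^+ 2) +
  n.+2%:R * q ^+ n.+1 * normc h ^+ 2 <= _).
  apply: lerD.
    by apply: ler_pM; rewrite ?normc_ge0.
  apply: ler_wpM2r; first by rewrite mulr_ge0 ?normc_ge0.
  by apply: ler_wpM2l => //; rewrite lerXn2r ?nnegrE ?normc_ge0.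
rewrite -subr_ge0 (_ : _ - _ = n.+2%:R * q ^+ n.+1 * normc h ^+ 2); last first.
  by rewrite -[n.+3%:R]natr1 -[n.+2%:R]natr1 exprS; ring.
by rewrite !mulr_ge0 ?exprn_ge0 ?normc_ge0.
Qed.

Lemma pseries_taylor a z h n :
  pseries a (z + h) n.+2 - pseries a z n.+2 - pseries (dseq a) z n.+1 * h =
  \sum_(k < n) a k.+2 * ((z + h) ^+ k.+2 - z ^+ k.+2 - k.+2%:R * z ^+ k.+1 * h).
Proof.
rewrite !pseriesE !big_ord_recl /= /bump /= ?add1n /dseq.
rewrite !expr0 !expr1 !mulr1 mul1r.
rewrite (_ : _ - _ - _ = \sum_(i < n) a i.+2 * (z + h) ^+ i.+2 -
  \sum_(i < n) a i.+2 * z ^+ i.+2 - (\sum_(i < n) i.+2%:R * a i.+2 * z ^+ i.+1) * h).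
  rewrite mulr_suml -!sumrB; apply: eq_bigr => i _; ring.
rewrite !mulrDl !mulrDr; ring.
Qed.

(** Partial sums have first-order error at most [K * normc h ^+ 2], where [K] bounds the twice
    derived series at a radius [q] between |z| and 1; this bound survives the limit. *)
Lemma ps_cderiv a z : rad_ge1 a -> normc z < 1 -> cderiv (ps a) z (ps (dseq a) z).
Proof.
move=> ra z1; have rda := rad_ge1_dseq ra.
pose q := (1 + normc z) / 2.
have q1 : q < 1 by rewrite /q; lra.
have zq : normc z < q by rewrite /q; lra.
have q0 : 0 <= q := ltW (le_lt_trans (normc_ge0 z) zq).
have [|K KP] := @rad_ge1_abs_summable _ q (rad_ge1_dseq rda); first by rewrite q0.
have K0 : 0 <= K by have := KP 0%N; rewrite big_ord0.
have H h : normc h < q - normc z ->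
    normc (ps a (z + h) - ps a z - ps (dseq a) z * h) <= K * normc h ^+ 2.
  move=> hr; have zhq : normc (z + h) < q by have := normcD z h; lra.
  have zh1 := lt_trans zhq q1.
  apply: (@cvg_normc_le (fun n => pseries a (z + h) n.+2 - pseries a z n.+2 -
    pseries (dseq a) z n.+1 * h)).
    apply: cvgB; first apply: cvgB.
    - have := pseries_cvg ra zh1; rewrite -cvg_shiftS -cvg_shiftS; exact.
    - have := pseries_cvg ra z1; rewrite -cvg_shiftS -cvg_shiftS; exact.
    - apply: cvgM; last exact: cvg_cst.
      have := pseries_cvg rda z1; rewrite -cvg_shiftS; exact.
  move=> n; rewrite pseries_taylor.
  apply: le_trans (ler_wpM2r _ (KP n)); last by rewrite exprn_ge0 ?normc_ge0.
  apply: (big_ind2 (fun (x : C) (y : R) => normc x <= y * normc h ^+ 2)).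
  - by rewrite normc0 mul0r.
  - move=> x1 x2 y1 y2 H1 H2; rewrite mulrDl.
    by apply: le_trans (normcD _ _) _; apply: lerD.
  - move=> i _; rewrite normcM /dseq !normcM !normc_nat.
    apply: le_trans (ler_wpM2l (normc_ge0 _) (normc_expr_taylor i (ltW zq) (ltW zhq))) _.
    by rewrite le_eqVlt; apply/orP; left; apply/eqP; ring.
apply/cderivP => e e0; exists (Num.min (q - normc z) (e / (K + 1))).
  by rewrite lt_min subr_gt0 zq divr_gt0 // ltr_wpDl.
move=> h; rewrite lt_min => /andP[/H h1]; rewrite ltr_pdivlMr ?ltr_wpDl // => h2.
apply: le_trans h1 _; rewrite expr2 mulrA ler_wpM2r ?normc_ge0 //.
by apply: le_trans (ltW h2); rewrite mulrC ler_wpM2l ?normc_ge0 // lerDl.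
Qed.

End PowerSeries.

(** * Cauchy products of power series *)

Section CauchyProduct.
Variable R : realType.
Local Notation C := (R[i]).
Implicit Types (a b : nat -> C) (z : C).

Definition conv a b n : C := \sum_(i < n.+1) a i * b (n - i)%N.

Lemma normc_sum (I : Type) (r : seq I) (P : pred I) (F : I -> C) :
  normc (\sum_(i <- r | P i) F i) <= \sum_(i <- r | P i) normc (F i).
Proof.
apply: (big_ind2 (fun (x : C) (y : R) => normc x <= y)) => //.
- by rewrite normc0.
- by move=> x1 x2 y1 y2 H1 H2; apply: le_trans (normcD _ _) _; apply: lerD.
Qed.

(** Below degree N the product of the truncations already has the coefficients of the Cauchy
    product, so only the degrees from N to 2N - 1 are left. *)
Lemma pseries_conv_trunc a b z N : (0 < N)%N ->
  let p := (\poly_(i < N) a i) * (\poly_(i < N) b i) in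
  pseries a z N * pseries b z N - pseries (conv a b) z N =
  \sum_(N <= n < N + N) p`_n * z ^+ n.
Proof.
move=> N0 p; rewrite !pseriesE -!(horner_poly N) -hornerM -/p.
have sp : (size p <= N + N)%N.
  apply: leq_trans (size_polyMleq _ _) _; apply: leq_trans (leq_pred _) _.
  by apply: leq_add; apply: size_poly.
rewrite (horner_coef_wide _ sp) -(big_mkord xpredT (fun n => p`_n * z ^+ n)).
rewrite (@big_cat_nat _ _ _ N) ?leq_addr //= big_mkord horner_poly.
rewrite [X in X + _ - _](_ : _ = \sum_(i < N) conv a b i * z ^+ i); first by ring.
apply: eq_bigr => i _; congr (_ * _); rewrite coefM; apply: eq_bigr => j _.
have jN : (j < N)%N by apply: leq_trans (ltn_ord i); rewrite ltnS -ltnS.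
rewrite !coef_poly jN ifT //; apply: leq_ltn_trans (ltn_ord i); exact: leq_subr.
Qed.

Lemma normc_coef_trunc_prod a b (q K L : R) N n : 0 <= q ->
  (forall n, normc (a n) * q ^+ n <= K) -> (forall n, normc (b n) * q ^+ n <= L) ->
  normc ((\poly_(i < N) a i) * (\poly_(i < N) b i))`_n * q ^+ n <= n.+1%:R * (K * L).
Proof.
move=> q0 aK bL; have qn m : 0 <= q ^+ m by rewrite exprn_ge0.
have tr (c : nat -> C) (M : R) m : (forall n, normc (c n) * q ^+ n <= M) ->
    normc (\poly_(i < N) c i)`_m * q ^+ m <= M.
  move=> cM; rewrite coef_poly; case: ifP => // _.
  by rewrite normc0 mul0r; apply: le_trans (cM 0%N); rewrite mulr_ge0 ?normc_ge0.
rewrite coefM; apply: le_trans (ler_wpM2r (qn n) (normc_sum _ _ _)) _.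
rewrite mulr_suml mulr_natl -[n.+1 in leRHS]card_ord -sumr_const.
apply: ler_sum => j _; rewrite normcM.
have -> : q ^+ n = q ^+ j * q ^+ (n - j) by rewrite -exprD subnKC // -ltnS.
rewrite mulrACA; apply: ler_pM; rewrite ?tr // mulr_ge0 ?normc_ge0 //.
Qed.

Lemma pseries_conv a b z : rad_ge1 a -> rad_ge1 b -> normc z < 1 ->
  pseries (conv a b) z n @[n --> \oo] --> (ps a z * ps b z : C^o).
Proof.
move=> ra rb z1.
pose x := (1 - normc z) / 4; have x0 : 0 < x by rewrite divr_gt0 // subr_gt0.
pose q := normc z + x + x + x.
have z0 := normc_ge0 z.
have q01 : 0 <= q < 1 by rewrite /q /x; lra.
have q0 : 0 < q by rewrite /q; lra.
have [[K KP] [L LP]] := (ra _ q01, rb _ q01).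
pose s := normc z / q.
have s0 : 0 <= s by rewrite divr_ge0 // ltW.
have s1 : s < 1 by rewrite ltr_pdivrMr // mul1r /q; lra.
(* Each [y] pays for one linear factor: n + 1 from the coefficient bound, and N from the number of
   terms in the tail. As s + 2y < 1, the tail still decays geometrically. *)
pose y := (1 - s) / 4; have y0 : 0 < y by rewrite divr_gt0 // subr_gt0.
have KL : 0 <= K * L.
  apply: mulr_ge0; [apply: le_trans (KP 0%N)|apply: le_trans (LP 0%N)];
  by rewrite expr0 mulr1 normc_ge0.
have KLy : 0 <= K * L / y / y := divr_ge0 (divr_ge0 KL (ltW y0)) (ltW y0).
have tailE N : (0 < N)%N -> normc (pseries a z N * pseries b z N - pseries (conv a b) z N)
    <= K * L / y / y * (s + y + y) ^+ N.
  move=> N0; rewrite pseries_conv_trunc //.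
  apply: le_trans (normc_sum _ _ _) _.
  apply: le_trans (_ : \sum_(N <= n < N + N) K * L / y * (s + y) ^+ N <= _).
    apply: ler_sum_nat => n /andP[Nn _].
    rewrite normcM normcX.
    have -> : normc z ^+ n = q ^+ n * s ^+ n.
      by rewrite -exprMn [q * s]mulrC divrK // unitfE gt_eqF.
    rewrite mulrA.
    apply: le_trans (ler_wpM2r _ (normc_coef_trunc_prod N n (ltW q0) KP LP)) _.
      by rewrite exprn_ge0.
    rewrite [leLHS](_ : _ = K * L / y * (n.+1%:R * s ^+ n * y)); last first.
      by field; rewrite gt_eqF.
    apply: ler_wpM2l; first by rewrite divr_ge0 // ltW.
    apply: le_trans (expr_add_ge n s0 (ltW y0)) _.
    apply: ler_wiXn2l; rewrite ?(leq_trans Nn) // /y; lra.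
  rewrite sumr_const_nat addnK -mulr_natl.
  rewrite [leLHS](_ : _ = K * L / y / y * (N%:R * (s + y) ^+ N * y)); last first.
    by field; rewrite gt_eqF.
  apply: ler_wpM2l; first exact: KLy.
  case: N N0 => // N _.
  have sy0 : 0 <= s + y by rewrite addr_ge0 // ltW.
  apply: le_trans (expr_add_ge N sy0 (ltW y0)).
  rewrite -!mulrA ler_wpM2l // ler_wpM2r ?(ltW y0) //.
  by apply: ler_wiXn2l => //; rewrite /y; lra.
have cAB : (pseries a z n * pseries b z n : C^o) @[n --> \oo] --> (ps a z * ps b z : C^o).
  by apply: cvgM; apply: pseries_cvg.
rewrite (_ : pseries (conv a b) z = fun n => pseries a z n * pseries b z n -
  (pseries a z n * pseries b z n - pseries (conv a b) z n)); last first.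
  by apply/funext => n; rewrite opprB addrCA subrr addr0.
suff c0 : (pseries a z n * pseries b z n - pseries (conv a b) z n : C^o)
    @[n --> \oo] --> (0 : C^o).
  by have := cvgB cAB c0; rewrite subr0; apply.
apply/cvg_normcP => e e0.
have M0 : 0 < K * L / y / y + 1 by rewrite ltr_wpDl.
have [||N NP] := @cvg_expr0 R (s + y + y) _ (e / (K * L / y / y + 1)).
- by rewrite /y; lra.
- by rewrite divr_gt0.
exists N.+1 => n Nn; rewrite sub0r normc_opp.
apply: le_lt_trans (tailE n (leq_trans _ Nn)) _ => //.
have := NP n (ltnW Nn); rewrite ltr_pdivlMr // mulrC => /(le_lt_trans _); apply.
by rewrite ler_wpM2r ?lerDl // exprn_ge0 // /y; lra.
Qed.

End CauchyProduct.

(** * The complex exponential and the principal square root *)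

Section ComplexExp.
Variable R : realType.
Local Notation C := (R[i]).
Implicit Types (z w : C).

Lemma real_derive_bound (f : R -> R) (x d : R) : is_derive x 1 f d ->
  forall e : R, 0 < e -> exists2 r : R, 0 < r &
    forall h, `|h| < r -> `|f (x + h) - f x - d * h| <= e * `|h|.
Proof.
move=> df e e0.
have /derivable_nbhsP/eqaddoP/(_ e e0) := @ex_derive _ _ _ _ _ _ _ df.
move=> /nbhs_normP[r r0 rP]; exists r => // h hr.
have := rP h; rewrite /= sub0r normrN => /(_ hr).
rewrite !fctE /= (@derive_val _ _ _ _ _ _ _ df).
by rewrite [h%:A]mulr1 [_ *: d]mulrC opprD addrA [h + x]addrC.
Qed.

Lemma cexpD z w : cexp (z + w) = cexp z * cexp w.
Proof.
case: z w => a b [c d]; apply: complex_eqP;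
  by rewrite /cexp !(ReM, ImM) /= expRD cosD sinD; ring.
Qed.

Lemma cexp0 : cexp 0 = 1 :> C.
Proof. by rewrite /cexp /= expR0 cos0 sin0 mul1r. Qed.

Lemma cexpN z : cexp z * cexp (- z) = 1.
Proof. by rewrite -cexpD subrr cexp0. Qed.

Lemma cexp_neq0 z : cexp z != 0.
Proof.
by apply/eqP => E; have := cexpN z; rewrite E mul0r => /esym/eqP; rewrite oner_eq0.
Qed.

Lemma cderiv_cexp0 : cderiv (@cexp R) 0 1.
Proof.
apply/cderivP => e0 e00.
(* The real part costs 4e ([A1]) and the imaginary part 5e ([A2]), whence the 9. The condition e <=
   1 serves the crude bounds 2|x| for |exp x - 1| and 3 for exp x. *)
have [e e_gt0 /andP[e1 e9]] : exists2 e : R, 0 < e & (e <= 1) && (9 * e <= e0).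
  exists (Num.min 1 (e0 / 9)); first by rewrite lt_min ltr01 divr_gt0.
  by rewrite ge_min lexx /= -ler_pdivlMl // mulrC ge_min lexx orbT.
have [r1 r10 r1P] := real_derive_bound (@is_derive_expR R 0) e_gt0.
have [r2 r20 r2P] := real_derive_bound (@is_derive_cos R 0) e_gt0.
have [r3 r30 r3P] := real_derive_bound (@is_derive_sin R 0) e_gt0.
exists (Num.min e (Num.min r1 (Num.min r2 r3))); first by rewrite !lt_min e_gt0 r10 r20.
move=> h; rewrite !lt_min => /and4P[he h1 h2 h3].
have hR := Re_le_normc h; have hI := Im_le_normc h.
have := r1P _ (le_lt_trans hR h1); have := r2P _ (le_lt_trans hI h2).
have := r3P _ (le_lt_trans hI h3).
rewrite !add0r expR0 cos0 sin0 oppr0 mul0r !mul1r !subr0 !addr0.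
set x := complex.Re h in hR *; set y := complex.Im h in hI *.
move=> Hs Hc He.
apply: le_trans (normc_le_ReIm _) _.
rewrite cexp0 !(ReD, ImD, ReN, ImN) /cexp !(ReM, ImM) /= -/x -/y.
rewrite !(mul0r, addr0, subr0).
have Ex : `|expR x - 1| <= 2 * `|x|.
  have := ler_normD (expR x - 1 - x) x; rewrite subrK => /le_trans; apply.
  have : e * `|x| <= 1 * `|x| by rewrite ler_wpM2r.
  lra.
have n1 : `|x| < 1 by lra.
have E3 : `|expR x| <= 3.
  have := ler_normD (expR x - 1) 1; rewrite subrK normr1 => /le_trans; apply; lra.
have A1 : `|expR x * cos y - 1 - x| <= e * normc h + 3 * (e * normc h).
  rewrite (_ : _ - x = (expR x - 1 - x) + expR x * (cos y - 1)); last by ring.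
  apply: le_trans (ler_normD _ _) _; rewrite normrM; apply: lerD.
    by apply: le_trans He _; rewrite ler_wpM2l // ltW.
  apply: ler_pM => //; apply: le_trans Hc _; by rewrite ler_wpM2l // ltW.
have A2 : `|expR x * sin y - y| <= 3 * (e * normc h) + 2 * (e * normc h).
  rewrite (_ : _ - y = expR x * (sin y - y) + (expR x - 1) * y); last by ring.
  apply: le_trans (ler_normD _ _) _; rewrite !normrM; apply: lerD.
    by apply: ler_pM => //; apply: le_trans Hs _; rewrite ler_wpM2l // ltW.
  rewrite mulrA; apply: ler_pM => //; apply: le_trans Ex _.
  by rewrite ler_wpM2l // (le_trans hR) // ltW.
have : 9 * e * normc h <= e0 * normc h by rewrite ler_wpM2r ?normc_ge0.
move: A1 A2; lra.
Qed.

Lemma cderiv_cexp z : cderiv (@cexp R) z (cexp z).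
Proof.
apply/cderivP => e e0.
have k0 : 0 < normc (cexp z) by rewrite normc_gt0 cexp_neq0.
have /cderivP/(_ (e / normc (cexp z)))[|r r0 rP] := cderiv_cexp0.
  by rewrite divr_gt0.
exists r => // h /rP; rewrite add0r cexp0 mul1r cexpD => H.
rewrite (_ : _ - _ = cexp z * (cexp h - 1 - h)); last by ring.
rewrite normcM; apply: le_trans (ler_wpM2l (normc_ge0 _) H) _.
by rewrite mulrA mulrCA divff ?mulr1 ?gt_eqF.
Qed.

Lemma csqrt_sqr z : 0 < complex.Re z -> csqrt (z ^+ 2) = z.
Proof.
case: z => p q /= p0; rewrite expr2 /csqrt /=.
have -> : (p * p - q * q) ^+ 2 + (p * q + q * p) ^+ 2 = (p ^+ 2 + q ^+ 2) ^+ 2 by ring.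
rewrite sqrtr_sqr ger0_norm ?addr_ge0 ?sqr_ge0 //.
rewrite (_ : _ / 2 = p ^+ 2); last by field.
rewrite (_ : _ / 2 = q ^+ 2); last by field.
rewrite !sqrtr_sqr (gtr0_norm p0) [q * p]mulrC -mulr2n.
rewrite pmulrn_llt0 // pmulr_rlt0 //.
by case: ltP => [q0|q0]; rewrite ?(ltr0_norm q0) ?opprK ?(ger0_norm q0).
Qed.

End ComplexExp.

(** * tanh and B as power series on the disc *)

Section BfunSeries.
Variable R : realType.
Local Notation C := (R[i]).
Implicit Types (a b u v : nat -> C) (z w : C).

(** Course-of-values recursion, since a convolution reads all earlier terms; the auxiliary list
    [s n] stores the first n values. *)
Lemma rec_seq (u0 : C) (G : nat -> (nat -> C) -> C) :
  (forall n u v, (forall k, (k <= n)%N -> u k = v k) -> G n u = G n v) ->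
  exists u, u 0%N = u0 /\ forall n, u n.+1 = G n u.
Proof.
move=> Gext.
pose fix s n : seq C := if n is m.+1 then
  rcons (s m) (if m is k.+1 then G k (nth 0 (s m)) else u0) else [::].
pose u n := nth 0 (s n.+1) n.
have ss n : size (s n) = n by elim: n => //= n IH; rewrite size_rcons IH.
have su n k : (k < n)%N -> nth 0 (s n) k = u k.
  elim: n => // n IH; rewrite ltnS leq_eqVlt => /predU1P[-> //|kn].
  by rewrite /= nth_rcons ss kn IH.
exists u; split; first by rewrite /u /=.
have sS n : s n.+2 = rcons (s n.+1) (G n (nth 0 (s n.+1))) by [].
move=> n; rewrite /u sS nth_rcons ss ltnn eqxx.
by apply: Gext => k kn; rewrite su.
Qed.

Lemma eq_conv a b a' b' n : (forall k, (k <= n)%N -> a k = a' k) ->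
  (forall k, (k <= n)%N -> b k = b' k) -> conv a b n = conv a' b' n.
Proof.
move=> aa bb; apply: eq_bigr => i _.
by rewrite aa ?bb ?leq_subr // -ltnS.
Qed.

(** The bound [n.+1] is cancelled exactly by the division by [n.+1] in the coefficient recursions of
    tanh and B, so that 1 remains a bound by induction. *)
Lemma normc_conv_le a b n : (forall k, (k <= n)%N -> normc (a k) <= 1) ->
  (forall k, (k <= n)%N -> normc (b k) <= 1) -> normc (conv a b n) <= n.+1%:R.
Proof.
move=> a1 b1; apply: le_trans (normc_sum _ _ _) _.
rewrite -[n.+1 in leRHS]card_ord -sumr_const; apply: ler_sum => i _.
by rewrite normcM mulr_ile1 ?normc_ge0 ?a1 ?b1 ?leq_subr // -ltnS.
Qed.

Lemma tanh_coefs : exists t : nat -> C, [/\ t 0%N = 0, forall n, normc (t n) <= 1 &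
  forall n, dseq t n = (n == 0%N)%:R - conv t t n].
Proof.
have [|t [t0 tS]] := @rec_seq 0 (fun n u => ((n == 0%N)%:R - conv u u n) / n.+1%:R).
  by move=> n u v uv; rewrite (eq_conv uv uv).
exists t; split=> // n; last first.
  by rewrite /dseq tS mulrCA divff ?mulr1 // pnatr_eq0.
elim/ltn_ind: n => -[_|n IH]; first by rewrite t0 normc0.
rewrite tS normcM normcV normc_nat ler_pdivrMr ?ltr0n // mul1r.
(* The constant of the equation occurs only for n = 0, where the convolution vanishes, so the two
   contributions never add up. *)
case: n IH => [_|n IH]; first by rewrite /conv big_ord1 t0 mul0r subr0 normc1.
by rewrite sub0r normc_opp; apply: normc_conv_le => k kn; apply: IH.
Qed.

Lemma Bfun_coefs t : (forall n, normc (t n) <= 1) -> exists b : nat -> C, [/\ b 0%N = 1,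
  forall n, normc (b n) <= 1 & forall n, dseq b n = (b n - conv t b n) / 2].
Proof.
move=> t1.
have [|b [b0 bS]] := @rec_seq 1 (fun n u => (u n - conv t u n) / 2 / n.+1%:R).
  by move=> n u v uv; rewrite (@eq_conv t u t v) ?uv.
exists b; split=> // n; last first.
  by rewrite /dseq bS mulrCA divff ?mulr1 // pnatr_eq0.
elim/ltn_ind: n => -[_|n IH]; first by rewrite b0 normc1.
rewrite bS !normcM !normcV !normc_nat ler_pdivrMr ?ltr0n // mul1r.
(* It remains that 1 + (n + 1) <= 2 (n + 1): the factor 1/2 in the equation closes the induction. *)
rewrite ler_pdivrMr //; apply: le_trans (normcB _ _) _.
have := normc_conv_le (fun k _ => t1 k) IH; have := IH n (ltnSn n).
by rewrite -[n.+1%:R]natr1; have := ler0n R n; lra.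
Qed.

(** One transfer from recursions to differential equations for both series: (x, y, k) is (1, 0, -1)
    for tanh and (0, 1/2, -1/2) for B. *)
Lemma ps_dseq_conv a c (x y k : C) z : rad_ge1 a -> rad_ge1 c -> normc z < 1 ->
  (forall n, dseq c n = x * (n == 0%N)%:R + y * c n + k * conv a c n) ->
  ps (dseq c) z = x + y * ps c z + k * (ps a z * ps c z).
Proof.
move=> ra rc z1 dc; apply: pseries_unique => //; first exact: rad_ge1_dseq.
have c1 : pseries (fun n => (n == 0%N)%:R : C) z n @[n --> \oo] --> (1 : C^o).
  apply/cvg_normcP => e e0; exists 1%N => -[//|n] _.
  rewrite pseriesE big_ord_recl big1 ?addr0; last by move=> i _; rewrite mul0r.
  by rewrite expr0 mul1r subrr normc0.
rewrite (_ : pseries _ z = fun n => x * pseries (fun n => (n == 0%N)%:R : C) z n +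
  y * pseries c z n + k * pseries (conv a c) z n).
  rewrite -[X in X + _ + _]mulr1; apply: cvgD; first apply: cvgD.
  - exact: (cvgM (cvg_cst _) c1).
  - exact: (cvgM (cvg_cst _) (pseries_cvg rc z1)).
  - exact: (cvgM (cvg_cst _) (pseries_conv ra rc z1)).
apply/funext => n; rewrite !pseriesE !mulr_sumr -!big_split /=.
by apply: eq_bigr => i _; rewrite dc; ring.
Qed.

(** The relation with the exponential is multiplied out because cosh is not yet known to be free of
    zeros on the disc. *)
Lemma tanh_series : exists t : nat -> C, [/\ forall n, normc (t n) <= 1,
  forall z, normc z < 1 -> cderiv (ps t) z (1 - ps t z ^+ 2) &
  forall z, normc z < 1 -> ps t z * (cexp z + cexp (- z)) = cexp z - cexp (- z)].
Proof.
have [t [t0 t1 dt]] := tanh_coefs; have rt := rad_ge1_bounded t1.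
have dT z : normc z < 1 -> cderiv (ps t) z (1 - ps t z ^+ 2).
  move=> z1; apply: cderiv_eq (ps_cderiv rt z1) _.
  rewrite (@ps_dseq_conv t t 1 0 (-1)) //; first by ring.
  by move=> n; rewrite dt; ring.
exists t; split=> // z z1.
have [|u [u0 uS]] := @rec_seq 0 (fun n _ => t n / n.+1%:R); first by [].
have du : dseq u = t.
  by apply/funext => n; rewrite /dseq uS mulrCA divff ?mulr1 // pnatr_eq0.
have ru : rad_ge1 u.
  apply: (@rad_ge1_bounded _ _ 1) => -[|n]; first by rewrite u0 normc0.
  rewrite uS normcM normcV normc_nat ler_pdivrMr ?ltr0n // mul1r.
  by apply: le_trans (t1 n) _; rewrite ler1n.
(* [G' = - T G] and [u] is a primitive of [T], so [G exp u] is constant. *)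
pose G x := ps t x * (cexp x + cexp (- x)) - (cexp x - cexp (- x)).
have dexpN x : cderiv (fun y : C => cexp (- y)) x (- cexp (- x)).
  apply: cderiv_eq (cderiv_comp (cderivN (cderiv_id x)) (cderiv_cexp (- x))) _.
  by rewrite mulrN1.
have dG x : normc x < 1 -> cderiv (fun y => G y * cexp (ps u y)) x 0.
  move=> x1; apply: cderiv_eq.
    apply: cderivM.
      apply: cderivB; last exact: cderivB (cderiv_cexp _) (dexpN _).
      exact: cderivM (dT _ x1) (cderivD (cderiv_cexp _) (dexpN _)).
    exact: cderiv_comp (ps_cderiv ru x1) (cderiv_cexp _).
  by rewrite du /G; ring.
have := cderiv0_cst dG z1.
rewrite {2}/G (ps0 rt) t0 oppr0 cexp0 subrr mul0r subr0 mul0r => /eqP.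
by rewrite mulf_eq0 (negPf (cexp_neq0 _)) orbF subr_eq0 => /eqP.
Qed.

(** The imaginary part of 2z lies in (-2, 2) and 2 < pi, so exp(2z) is real only for real z, and
    then positive. This keeps B off the imaginary axis. *)
Lemma cexp_not_le0 z (s : R) : normc z < 1 -> 0 <= s -> cexp (z + z) != - s%:C.
Proof.
move=> z1 s0; apply/eqP => E.
have y1 : `|complex.Im z| < 1 := le_lt_trans (Im_le_normc z) z1.
have := congr1 (@complex.Im R) E; rewrite /cexp ImM ImN /= oppr0 mul0r addr0 ImD.
move=> /eqP; rewrite mulf_eq0 gt_eqF ?expR_gt0 //= => /eqP sin0.
have y0 : complex.Im z = 0.
  move: y1; rewrite ltr_norml => /andP[y1 y2].
  case: (ltgtP (complex.Im z) 0) => // y0.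
    have : 0 < sin (- (complex.Im z + complex.Im z)) by apply: sin2_gt0; lra.
    by rewrite sinN sin0 oppr0 ltxx.
  have : 0 < sin (complex.Im z + complex.Im z) by apply: sin2_gt0; lra.
  by rewrite sin0 ltxx.
have := congr1 (@complex.Re R) E; rewrite /cexp ReM ReN /= ImD y0 addr0 cos0 mul0r subr0 mulr1.
by have := expR_gt0 (complex.Re (z + z)); lra.
Qed.

(** Everything rests on B^2 = 1 + tanh z = 2 / (1 + exp(-2z)). It excludes B^2 = 2, because exp has
    no zero, and an imaginary B, because exp(-2z) would then be a negative real. *)
Lemma Bfun_series : exists b : nat -> C, [/\ b 0%N = 1, forall n, normc (b n) <= 1,
  forall z, normc z < 1 -> cderiv (ps b) z (ps b z - ps b z ^+ 3 / 2),
  forall z, normc z < 1 -> Bfun z = ps b z /\ 0 < complex.Re (ps b z) &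
  forall z, normc z < 1 -> ps b z ^+ 2 != 2].
Proof.
have [t [t1 dT tE]] := tanh_series; have rt := rad_ge1_bounded t1.
have [b [b0 b1 db]] := Bfun_coefs t1; have rb := rad_ge1_bounded b1.
have dB z : normc z < 1 -> cderiv (ps b) z (ps b z * (1 - ps t z) / 2).
  move=> z1; apply: cderiv_eq (ps_cderiv rb z1) _.
  rewrite (@ps_dseq_conv t b 0 2^-1 (- 2^-1)) //; first by ring.
  by move=> n; rewrite db; ring.
have dexpN x : cderiv (fun y : C => cexp (- y)) x (- cexp (- x)).
  apply: cderiv_eq (cderiv_comp (cderivN (cderiv_id x)) (cderiv_cexp (- x))) _.
  by rewrite mulrN1.
have tE2 z : normc z < 1 ->
    ps t z * (1 + cexp (- z) * cexp (- z)) = 1 - cexp (- z) * cexp (- z).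
  move=> /tE/(congr1 (fun x => x * cexp (- z))).
  by rewrite -mulrA !mulrDl mulNr cexpN.
(* The product is constant: 2 B B' = B^2 (1 - T), and T (1 + exp(-2z)) = 1 - exp(-2z) cancels the
   derivative. Its value at 0 is 2. *)
have HE z : normc z < 1 -> ps b z ^+ 2 * (1 + cexp (- z) * cexp (- z)) = 2.
  move=> z1; pose H x := ps b x * ps b x * (1 + cexp (- x) * cexp (- x)).
  have dH x : normc x < 1 -> cderiv H x 0.
    move=> x1; apply: cderiv_eq.
      apply: cderivM (cderivM (dB _ x1) (dB _ x1)) (cderivD (cderiv_cst _ _) _).
      exact: cderivM (dexpN _) (dexpN _).
    have := tE2 _ x1; set e := cexp (- x); set T := ps t x; set P := ps b x => E.
    rewrite [LHS](_ : _ = P ^+ 2 * (1 + e * e - T * (1 + e * e) - 2 * (e * e))).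
      by rewrite E; ring.
    by field.
  have := cderiv0_cst dH z1.
  rewrite /H (ps0 rb) b0 oppr0 cexp0 expr2 => ->; ring.
have e0 z : normc z < 1 -> 1 + cexp (- z) * cexp (- z) != 0.
  move=> /HE E; apply/eqP => F; move: E; rewrite F mulr0 => /esym/eqP.
  by rewrite pnatr_eq0.
have PE z : normc z < 1 -> ps b z ^+ 2 = 1 + ps t z.
  move=> z1; apply: (mulIf (e0 _ z1)); rewrite HE // mulrDl tE2 //; ring.
have P2 z : normc z < 1 -> ps b z ^+ 2 != 2.
  move=> z1; apply/eqP => E; have := HE _ z1; rewrite E => /eqP.
  rewrite -subr_eq0 mulrDr mulr1 addrAC subrr add0r mulf_eq0 pnatr_eq0 /=.
  by rewrite mulf_eq0 !(negPf (cexp_neq0 _)).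
have Re_neq0 z : normc z < 1 -> complex.Re (ps b z) != 0.
  move=> z1; apply/eqP => Re0.
  pose y := complex.Im (ps b z).
  have sq : ps b z ^+ 2 = - (y ^+ 2)%:C.
    rewrite /y; move: Re0; case: (ps b z) => p q /= ->; rewrite expr2.
    by apply: complex_eqP => /=; ring.
  have y0 : y ^+ 2 != 0.
    apply/eqP => y0; have := HE _ z1; rewrite sq y0 oppr0 mul0r => /esym/eqP.
    by rewrite pnatr_eq0.
  have y20 : 0 < y ^+ 2 by rewrite lt_def y0 sqr_ge0.
  have Nz1 : normc (- z) < 1 by rewrite normc_opp.
  (* For B = iy the identity [HE] reads -y^2 (1 + exp(-2z)) = 2, that is exp(-2z) = -(1 + 2 /
     y^2). *)
  have := @cexp_not_le0 (- z) (1 + 2 / y ^+ 2) Nz1; rewrite addr_ge0 ?divr_ge0 ?(ltW y20) //.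
  move=> /(_ isT)/eqP; apply; rewrite cexpD.
  have yC0 : (y ^+ 2)%:C != 0 by rewrite fmorph_eq0.
  apply: (mulfI yC0); have := HE _ z1; rewrite sq rmorphD fmorph_div rmorph1 rmorph_nat.
  set q := (y ^+ 2)%:C in yC0 *; set ee := cexp _ * _ => E.
  rewrite mulrN mulrDr mulr1 [q * (2 / q)]mulrC divfK // opprD -E; ring.
(* [Re (ps b)] has no zero on the disc and is 1 at the origin, so [ps b] is the principal
   square root. *)
have Re_gt0 z : normc z < 1 -> 0 < complex.Re (ps b z).
  move=> z1; rewrite lt_def Re_neq0 //= leNgt; apply/negP => neg.
  pose F (s : R) := complex.Re (1 * ps b (0 + s%:C * z)).
  have FE s : F s = complex.Re (ps b (s%:C * z)) by rewrite /F mul1r add0r.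
  have seg (s : R) : 0 <= s <= 1 -> normc (0 + s%:C * z) < 1.
    by move=> s01; apply: normc_segment; rewrite ?add0r ?normc0 ?ltr01.
  have F0 : F 0 = 1 by rewrite FE rmorph0 mul0r (ps0 rb) b0.
  have F1 : F 1 = complex.Re (ps b z) by rewrite FE rmorph1 mul1r.
  have [||s] := @IVT R F 0 1 0 ler01.
  - apply: derivable_within_continuous => x; rewrite in_itv /= => x01.
    by case: (cderiv_line 1 (dB _ (seg x x01))).
  - by rewrite F0 F1 ge_min (ltW neg) orbT le_max ler01.
  - rewrite in_itv FE => /seg; rewrite add0r => s1 /eqP.
    by rewrite (negPf (Re_neq0 _ s1)).
exists b; split=> // [z z1|z z1].
  apply: cderiv_eq (dB z z1) _.
  have -> : ps t z = ps b z ^+ 2 - 1 by rewrite PE //; ring.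
  by field.
split; last exact: Re_gt0.
have cosh0 : cexp z + cexp (- z) != 0.
  apply/eqP => ch0; have := e0 z z1; rewrite -[1](cexpN z) -mulrDl ch0 mul0r eqxx.
  by [].
rewrite /Bfun /ctanh -tE // mulfK // -PE // csqrt_sqr //; exact: Re_gt0.
Qed.

End BfunSeries.

(** * Second-order expansion excludes interior maxima *)

Section MaxPrinciple.
Variable R : realType.
Local Notation C := (R[i]).
Implicit Types (f g : C -> C) (z w : C) (S : C -> Prop).

(** The second derivative is only asked to exist pointwise, which is all that an expansion at a
    maximum uses. Later [S] is the punctured disc, where division by z is allowed. *)
Definition twice_cderiv S g := exists g1 : C -> C, forall z, S z ->
  cderiv g z (g1 z) /\ exists d, cderiv g1 z d.

Lemma twice_cderiv_cst S c : twice_cderiv S (fun=> c).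
Proof.
by exists (fun=> 0) => z _; split; [|exists 0]; apply: cderiv_cst.
Qed.

Lemma twice_cderiv_id S : twice_cderiv S id.
Proof.
exists (fun=> 1) => z _; split; first exact: cderiv_id.
by exists 0; apply: cderiv_cst.
Qed.

Lemma twice_cderivB S f g : twice_cderiv S f -> twice_cderiv S g ->
  twice_cderiv S (fun z => f z - g z).
Proof.
move=> [f1 F] [g1 G]; exists (fun z => f1 z - g1 z) => z Sz.
have [[df [d dd]] [dg [d' dd']]] := (F z Sz, G z Sz).
by split; [|exists (d - d')]; apply: cderivB.
Qed.

Lemma twice_cderivM S f g : twice_cderiv S f -> twice_cderiv S g ->
  twice_cderiv S (fun z => f z * g z).
Proof.
move=> [f1 F] [g1 G]; exists (fun z => f z * g1 z + g z * f1 z) => z Sz.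
have [[df [d dd]] [dg [d' dd']]] := (F z Sz, G z Sz).
split; first exact: cderivM.
eexists; apply: cderivD; apply: cderivM; eassumption.
Qed.

Lemma twice_cderivX S f n : twice_cderiv S f -> twice_cderiv S (fun z => f z ^+ n).
Proof.
move=> F; elim: n => [|n IH]; first exact: twice_cderiv_cst.
rewrite (_ : (fun z => _) = fun z => f z * f z ^+ n); first exact: twice_cderivM.
by apply/funext => z; rewrite exprS.
Qed.

Lemma twice_cderivV S f : (forall z, S z -> f z != 0) -> twice_cderiv S f ->
  twice_cderiv S (fun z => (f z)^-1).
Proof.
move=> f0 [f1 F]; exists (fun z => - f1 z / f z ^+ 2) => z Sz.
have [df [d dd]] := F z Sz.
split; first by apply: cderivV => //; apply: f0.
eexists; apply: cderivM; first exact: cderivN dd.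
apply: cderivV; last exact: (cderivM df df).
by rewrite expf_neq0 // f0.
Qed.

Lemma normc_parallelogram z w :
  normc (z + w) ^+ 2 + normc (z - w) ^+ 2 = 2 * (normc z ^+ 2 + normc w ^+ 2).
Proof. by rewrite !normc_sqr !(ReD, ImD, ReN, ImN); ring. Qed.

(** The parallelogram law applied twice: the pairs v, -v separate the B terms, and v = 1, v = 'i,
    whose squares are opposite, separate A from D. *)
Lemma normc_sqr_four (A B D : C) (t : R) :
  let P v := normc (A + B * (t%:C * v) + D * (t%:C * v) ^+ 2) ^+ 2 in
  P 1 + P (-1) + P 'i + P (- 'i) =
  4 * (normc A ^+ 2 + normc B ^+ 2 * t ^+ 2 + normc D ^+ 2 * t ^+ 4).
Proof.
pose q : C := t%:C.
have pair v : normc (A + B * (q * v) + D * (q * v) ^+ 2) ^+ 2 +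
    normc (A + B * (q * - v) + D * (q * - v) ^+ 2) ^+ 2 =
    2 * (normc (A + D * q ^+ 2 * v ^+ 2) ^+ 2 + normc (B * (q * v)) ^+ 2).
  rewrite -normc_parallelogram; congr (normc _ ^+ 2 + normc _ ^+ 2); ring.
move=> P; rewrite -addrA /P !pair sqr_i expr1n mulr1 mulrN1.
have qt : normc q ^+ 2 = t ^+ 2 by rewrite normc_real real_normK ?num_real.
have i1 : normc ('i : C) = 1 by rewrite /= expr0n add0r expr1n sqrtr1.
have := normc_parallelogram A (D * q ^+ 2).
rewrite !normcM !exprMn normc1 i1 expr1n !mulr1 qt => E.
by rewrite (exprD t 2 2); move: E; lra.
Qed.

(* Averaging over the four points [z + i^k t] kills the linear and quadratic cross
   terms of [|g|^2], which leaves the nonnegative Laplacian; the term [e |z|^2] makes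
   it positive. *)
Lemma no_local_max g (g1 : C -> C) z (g2 : C) (r e : R) : 0 < r -> 0 < e ->
  (forall h, normc h < r -> cderiv g (z + h) (g1 (z + h))) -> cderiv g1 z g2 ->
  exists2 h, normc h < r &
    normc (g z) ^+ 2 + e * normc z ^+ 2 <
    normc (g (z + h)) ^+ 2 + e * normc (z + h) ^+ 2.
Proof.
move=> r0 e0 dg dg1.
set A := g z; set B := g1 z; pose D := g2 / 2.
pose M := normc A + normc B + normc D + 1.
have M0 : 0 < M by rewrite /M ltr_wpDl // !addr_ge0 ?normc_ge0.
(* Each of the four points loses at most 2 M eta t^2, in total 8 M eta t^2 = 2 e t^2, which is half
   of the gain 4 e t^2 coming from e |z|^2. *)
pose eta := e / (4 * M).
have eta0 : 0 < eta by rewrite divr_gt0 // mulr_gt0.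
have [s s0 sP] := cderiv_taylor2 r0 dg dg1 eta0.
have [t t0 [t1 tr ts]] : exists2 t : R, 0 < t & [/\ t <= 1, t < r & t < s].
  exists (Num.min 1 (Num.min (r / 2) (s / 2))); first by rewrite !lt_min ltr01 !divr_gt0.
  split; first by rewrite ge_min lexx.
    by rewrite !gt_min; apply/orP; right; apply/orP; left; lra.
  by rewrite !gt_min; apply/orP; right; apply/orP; right; lra.
have lb (v : C) : normc v = 1 ->
    normc (A + B * (t%:C * v) + D * (t%:C * v) ^+ 2) ^+ 2 - 2 * M * eta * t ^+ 2 <=
    normc (g (z + t%:C * v)) ^+ 2.
  move=> v1; set h := t%:C * v.
  have ht : normc h = t by rewrite normcM normc_real ger0_norm ?(ltW t0) // v1 mulr1.
  have := sP h; rewrite ht => /(_ ts).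
  set P := A + _ + _; set G := g (z + h).
  rewrite -/A -/B -/D (_ : _ - _ - _ - _ = G - P); last by rewrite /P; ring.
  move=> GP.
  have PM : normc P <= M.
    apply: le_trans (normcD _ _) _; apply: le_trans (lerD (normcD _ _) (lexx _)) _.
    rewrite (normcM B) (normcM D) normcX ht /M.
    have : normc B * t <= normc B * 1 by rewrite ler_wpM2l ?normc_ge0.
    have : normc D * t ^+ 2 <= normc D * 1.
      by rewrite ler_wpM2l ?normc_ge0 // exprn_ile1 // ltW.
    lra.
  have PG : normc P <= normc G + eta * t ^+ 2.
    have := normcD G (- (G - P)); rewrite opprB addrCA subrr addr0 -[P - G]opprB normc_opp; lra.
  have H1 : 0 <= eta * t ^+ 2 by rewrite mulr_ge0 ?sqr_ge0 // ltW.
  have := normc_ge0 P; have := normc_ge0 G.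
  rewrite -[2 * M * eta * _]mulrA; set x := normc G in PG *; set y := normc P in PM PG *.
  set k := eta * _ in H1 PG *; move=> x0 y0.
  have : y * k <= M * k by rewrite ler_wpM2r.
  (* If y < k, then y^2 <= M k and the lower bound to be proved is at most -M k, hence trivial. *)
  have [yk|ky] := leP k y; last by nra.
  have : (y - k) ^+ 2 <= x ^+ 2 by rewrite lerXn2r ?nnegrE //; lra.
  nra.
have sum4 : \sum_(v <- [:: 1; -1; 'i; - 'i]) (normc (g (z + t%:C * v)) ^+ 2 +
     e * normc (z + t%:C * v) ^+ 2) > 4 * (normc A ^+ 2 + e * normc z ^+ 2).
  rewrite !big_cons big_nil.
  have i1 : normc ('i : C) = 1 by rewrite /= expr0n add0r expr1n sqrtr1.
  have := lb 1 (normc1 _); have := lb (-1); rewrite normc_opp normc1 => /(_ erefl).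
  have := lb 'i i1; have := lb (- 'i); rewrite normc_opp i1 => /(_ erefl).
  have small : 8 * M * eta * t ^+ 2 < 4 * e * t ^+ 2.
    rewrite ltr_pM2r ?exprn_gt0 // /eta (_ : _ * (e / _) = 2 * e); last first.
      by field; rewrite gt_eqF.
    by lra.
  have zE (v : C) : normc (z + t%:C * v) ^+ 2 =
      normc (z + 1 * (t%:C * v) + 0 * (t%:C * v) ^+ 2) ^+ 2.
    by rewrite mul1r mul0r addr0.
  have AE := normc_sqr_four A B D t; have := normc_sqr_four z 1 0 t.
  move: AE; cbv beta zeta; rewrite -!zE normc0 normc1 expr1n mul1r expr0n mul0r addr0.
  have : 0 <= normc B ^+ 2 * t ^+ 2 by rewrite mulr_ge0 ?sqr_ge0.
  have : 0 <= normc D ^+ 2 * t ^+ 4 by rewrite mulr_ge0 ?sqr_ge0 // exprn_even_ge0.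
  rewrite -![2 * M * eta * _]mulrA; rewrite -![8 * M * eta * _]mulrA in small.
  set k := M * (eta * t ^+ 2) in small *; move: small.
  set b := normc B ^+ 2 * _; set d := normc D ^+ 2 * _.
  set z1 := normc (z + t%:C * 1) ^+ 2; set z2 := normc (z + t%:C * -1) ^+ 2.
  set z3 := normc (z + t%:C * 'i) ^+ 2; set z4 := normc (z + t%:C * - 'i) ^+ 2.
  move=> small d0 b0 AE E p4 p3 p2 p1.
  have eE := congr1 (fun x => e * x) E; rewrite /= in eE.
  lra.
apply: contrapT => H.
have H' v : normc v = 1 -> normc (g (z + t%:C * v)) ^+ 2 + e * normc (z + t%:C * v) ^+ 2
    <= normc A ^+ 2 + e * normc z ^+ 2.
  move=> v1; rewrite leNgt; apply/negP => lt; apply: H; exists (t%:C * v) => //.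
  by rewrite normcM normc_real v1 mulr1 ger0_norm // ltW.
move: sum4; rewrite ltNge => /negP; apply; rewrite !big_cons big_nil.
have i1 : normc ('i : C) = 1 by rewrite /= expr0n add0r expr1n sqrtr1.
have := H' 1 (normc1 _); have := H' (-1); rewrite normc_opp normc1 => /(_ erefl).
have := H' 'i i1; have := H' (- 'i); rewrite normc_opp i1 => /(_ erefl).
lra.
Qed.

End MaxPrinciple.

(** * Maximum principle with a removable singularity *)

Section Schwarz.
Variable R : realType.
Local Notation C := (R[i]).
Implicit Types (f g : C -> C) (z w : C).

Definition punctured z := 0 < normc z < 1.

(** The disc is carried to the real plane, where it is a closed part of a compact square and the
    extreme value theorem applies. *)
Lemma disc_argmax (u : C -> R) (r : R) : 0 <= r ->
  (forall z, normc z <= r -> forall e : R, 0 < e -> exists2 d : R, 0 < d &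
     forall h, normc h < d -> `|u (z + h) - u z| < e) ->
  exists2 m, normc m <= r & forall z, normc z <= r -> u z <= u m.
Proof.
move=> r0 uc.
pose T := (R * R)%type.
pose toC (p : T) : C := p.1 +i* p.2.
pose K : set T := [set p | p.1 ^+ 2 + p.2 ^+ 2 <= r ^+ 2].
have KE p : K p <-> normc (toC p) <= r.
  rewrite -[X in _ <-> is_true X](@ler_pXn2r R 2) ?nnegrE ?normc_ge0 //.
  by rewrite normc_sqr.
have cK : compact K.
  apply: (@subclosed_compact _ K (`[- r, r]%classic `*` `[- r, r]%classic)).
  - have cf : continuous (fun p : T => p.1 ^+ 2 + p.2 ^+ 2).
      move=> p; apply: cvgD; rewrite expr2; apply: cvgM; first [exact: cvg_fst|exact: cvg_snd].
    exact: (closed_comp (fun p _ => cf p) (@closed_le R (r ^+ 2))).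
  - by apply: compact_setX; apply: segment_compact.
  - move=> [x y] /KE pr; split => /=; rewrite in_itv /= -ler_norml.
      exact: le_trans (Re_le_normc (toC (x, y))) pr.
    exact: le_trans (Im_le_normc (toC (x, y))) pr.
have [|||m mK mM] := @compact_EVT_max T R (u \o toC) K.
- by exists (0, 0); apply/KE; rewrite normc0.
- exact: cK.
- apply: continuous_in_subspaceT => p /set_mem/KE pr.
  apply/cvgrPdist_lt => e e0; have [d d0 dP] := uc _ pr e e0.
  have d2 : 0 < d / 2 by rewrite divr_gt0.
  exists (ball p.1 (d / 2), ball p.2 (d / 2)); first by split; apply: nbhsx_ballx.
  move=> q [/= q1 q2].
  rewrite distrC (_ : toC q = toC p + (toC q - toC p)); last by rewrite addrCA subrr addr0.
  apply: dP; apply: le_lt_trans (normc_le_ReIm _) _.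
  rewrite ReD ImD ReN ImN /= [ltRHS]splitr; apply: ltrD; rewrite distrC.
    exact: q1.
  exact: q2.
exists (toC m); first by apply/KE/set_mem.
move=> z zr; have := mM (complex.Re z, complex.Im z).
by rewrite /= (_ : toC _ = z) //; [apply; apply/mem_set/KE; case: z zr | case: z zr].
Qed.

Lemma normc_lip z h : `|normc (z + h) - normc z| <= normc h.
Proof.
rewrite ler_norml; have := normcD z h; have := normcD (z + h) (- h).
rewrite addrK normc_opp; lra.
Qed.

(** The function |f|^2 + e |z|^2 attains its maximum on the closed disc. At 0 it vanishes, which is
    why continuity suffices there; on the circle it is at most M^2 + e; elsewhere [no_local_max]
    forbids a maximum. Finally e tends to 0. *)
Lemma max_principle f (r M : R) : 0 < r -> r < 1 -> 0 <= M ->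
  twice_cderiv punctured f -> f 0 = 0 ->
  (forall e : R, 0 < e -> exists2 d : R, 0 < d & forall h, normc h < d -> normc (f h) < e) ->
  (forall z, normc z = r -> normc (f z) <= M) ->
  forall z, normc z <= r -> normc (f z) <= M.
Proof.
move=> r0 r1 M0 [f1 df] f0 fc0 fM z zr.
suff H (e : R) : 0 < e -> normc (f z) ^+ 2 <= M ^+ 2 + e.
  by rewrite -(@ler_pXn2r R 2) ?nnegrE ?normc_ge0 //; apply/ler_addgt0Pr.
move=> e0.
pose u x := normc (f x) ^+ 2 + e * normc x ^+ 2.
have sqc (g : C -> C) x : (forall e : R, 0 < e -> exists2 d : R, 0 < d & forall h, normc h < d ->
    normc (g (x + h) - g x) < e) -> forall e : R, 0 < e -> exists2 d : R, 0 < d &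
    forall h, normc h < d -> `|normc (g (x + h)) ^+ 2 - normc (g x) ^+ 2| < e.
  move=> gc e' e'0; pose k := 2 * normc (g x) + 1.
  have k0 : 0 < k by rewrite ltr_wpDl // mulr_ge0 ?normc_ge0.
  have [|d d0 dP] := gc (Num.min 1 (e' / k)); first by rewrite lt_min ltr01 divr_gt0.
  exists d => // h /dP {dP}; rewrite lt_min => /andP[d1]; rewrite ltr_pdivlMr // => d2.
  have := normc_lip (g x) (g (x + h) - g x); rewrite addrCA subrr addr0.
  set X := normc (g (x + h)); set Y := normc (g x) in k k0 d2 *.
  set Z := normc (_ - _) in d1 d2 * => XY.
  apply: le_lt_trans d2; rewrite subr_sqr normrM; apply: ler_pM => //.
  have Y0 : 0 <= Y := normc_ge0 _; have X0 : 0 <= X := normc_ge0 _.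
  rewrite ger0_norm ?addr_ge0 //; move: XY; rewrite ler_norml => /andP[_ XY].
  by rewrite /k; lra.
have uc x : normc x <= r -> forall e' : R, 0 < e' -> exists2 d : R, 0 < d &
     forall h, normc h < d -> `|u (x + h) - u x| < e'.
  move=> xr e' e'0.
  have fc : forall e : R, 0 < e -> exists2 d : R, 0 < d & forall h, normc h < d ->
      normc (f (x + h) - f x) < e.
    have [-> e1 /fc0[d d0 dP]|xn] := eqVneq x 0.
      by exists d => // h /dP; rewrite add0r f0 subr0.
    have [|dfx _] := df x; last exact: cderiv_cont dfx.
    by rewrite /punctured normc_gt0 xn (le_lt_trans xr).
  have [|d1 d10 d1P] := sqc f x fc (e' / 2); first by rewrite divr_gt0.
  have [|d2 d20 d2P] := sqc id x (cderiv_cont (cderiv_id x)) (e' / 2 / e).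
    by rewrite !divr_gt0.
  exists (Num.min d1 d2); first by rewrite lt_min d10.
  move=> h; rewrite lt_min => /andP[/d1P h1 /d2P h2].
  rewrite /u (_ : _ - _ = (normc (f (x + h)) ^+ 2 - normc (f x) ^+ 2) +
    e * (normc (x + h) ^+ 2 - normc x ^+ 2)); last by ring.
  apply: le_lt_trans (ler_normD _ _) _; rewrite normrM (gtr0_norm e0).
  move: h2; rewrite ltr_pdivlMr // mulrC; move: h1; lra.
have [m mr mM] := disc_argmax (ltW r0) uc.
have uz : normc (f z) ^+ 2 <= u z by rewrite /u lerDl mulr_ge0 ?sqr_ge0 // ltW.
apply: le_trans uz _; apply: le_trans (mM z zr) _.
have [m0|mn0] := eqVneq m 0.
  by rewrite m0 /u f0 normc0 expr0n /= mulr0 addr0 addr_ge0 ?sqr_ge0 // ltW.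
have [mr'|mr'] := eqVneq (normc m) r.
  rewrite /u mr'; apply: lerD.
    by rewrite lerXn2r ?nnegrE ?normc_ge0 ?fM.
  by rewrite ler_piMr ?(ltW e0) // exprn_ile1 // ltW.
exfalso; have mlt : normc m < r by rewrite lt_neqAle mr'.
have m_gt0 : 0 < normc m by rewrite normc_gt0.
pose s := Num.min (normc m) (r - normc m).
have s0 : 0 < s by rewrite lt_min m_gt0 subr_gt0.
have near h : normc h < s -> punctured (m + h) /\ normc (m + h) <= r.
  rewrite lt_min => /andP[h1 h2]; have := normc_lip m h; rewrite ler_norml => /andP[a b].
  split; first (apply/andP; split); lra.
have [_ [d dd]] : cderiv f m (f1 m) /\ exists d, cderiv f1 m d.
  by apply: df; rewrite /punctured m_gt0 (lt_trans mlt).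
have [h hs] := @no_local_max R f f1 m d s e s0 e0 (fun h hs => (df _ (near h hs).1).1) dd.
by have := mM _ (near h hs).2; rewrite /u leNgt => /negP.
Qed.

(* The maximum principle applies to [g^N z], which extends by 0 to the origin; then
   N tends to infinity. *)
Lemma removable_max g (r M : R) : 0 < r -> r < 1 -> 0 <= M ->
  twice_cderiv punctured g ->
  (exists d K : R, 0 < d /\ forall h, 0 < normc h < d -> normc (g h) <= K) ->
  (forall z, normc z = r -> normc (g z) <= M) ->
  forall z, 0 < normc z <= r -> normc (g z) <= M.
Proof.
move=> r0 r1 M0 dg [d [K [d0 gK]]] gM z /andP[z0 zr].
have H N : normc (g z) ^+ N * normc z <= M ^+ N.
  apply: (@le_trans _ _ (M ^+ N * r)); last first.
    by rewrite ler_piMr ?exprn_ge0 // ltW.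
  rewrite -normcX -normcM.
  apply: (@max_principle (fun z => g z ^+ N * z) r) zr => //.
  - by rewrite mulr_ge0 ?exprn_ge0 // ltW.
  - exact: twice_cderivM (twice_cderivX _ dg) (twice_cderiv_id _).
  - by rewrite mulr0.
  - move=> e e0; pose k := `|K| ^+ N + 1.
    have k0 : 0 < k by rewrite ltr_wpDl ?exprn_ge0.
    exists (Num.min d (e / k)); first by rewrite lt_min d0 divr_gt0.
    move=> h; rewrite lt_min => /andP[hd]; rewrite ltr_pdivlMr // => hk.
    have [->|hn] := eqVneq h 0; first by rewrite mulr0 normc0.
    rewrite normcM normcX mulrC; apply: le_lt_trans hk.
    rewrite ler_wpM2l ?normc_ge0 // /k; apply: le_trans (_ : `|K| ^+ N <= _); last by rewrite lerDl.
    rewrite lerXn2r ?nnegrE ?normc_ge0 ?normr_ge0 //; apply: le_trans (ler_norm K).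
    by apply: gK; rewrite normc_gt0 hn.
  - move=> x xr; rewrite normcM normcX xr ler_wpM2r ?(ltW r0) //.
    by rewrite lerXn2r ?nnegrE ?normc_ge0 ?gM.
rewrite leNgt; apply/negP => gt.
have g0 : 0 < normc (g z) := le_lt_trans M0 gt.
have [|N NP] := @cvg_expr0 R (M / normc (g z)) _ (normc z) z0.
  by rewrite divr_ge0 ?normc_ge0 //= ltr_pdivrMr // mul1r.
have := NP N (leqnn N); rewrite expr_div_n ltr_pdivrMr ?exprn_gt0 // mulrC.
by rewrite ltNge H.
Qed.

(** Schwarz's lemma for a quotient g = F / z with |F| <= 1: on the circle of radius r it satisfies
    |g| <= 1/r, and r may approach 1. It serves both w / z and the Schwarz-Pick quotient. *)
Lemma schwarz_gen g : twice_cderiv punctured g ->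
  (exists d K : R, 0 < d /\ forall h, 0 < normc h < d -> normc (g h) <= K) ->
  (forall z, punctured z -> normc (g z) * normc z <= 1) ->
  forall z, punctured z -> normc (g z) <= 1.
Proof.
move=> dg gK g1 z /andP[z0 z1]; rewrite leNgt; apply/negP => gt.
have [r [r0 r1 zr rg]] : exists r : R, [/\ 0 < r, r < 1, normc z <= r & 1 < normc (g z) * r].
  have gz0 : 0 < normc (g z) := lt_trans ltr01 gt.
  (* The midpoint of 1 and 1/|g z| lies below 1 and still makes |g z| r exceed 1; the maximum with
     |z| keeps z in the disc of radius r. *)
  exists (Num.max (normc z) ((1 + (normc (g z))^-1) / 2)); split.
  - by rewrite lt_max z0.
  - by rewrite gt_max z1 /= ltr_pdivrMr // mul1r ltrD2l invf_lt1.
  - by rewrite le_max lexx.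
  - apply: lt_le_trans (_ : normc (g z) * ((1 + (normc (g z))^-1) / 2) <= _).
      rewrite mulrA ltr_pdivlMr // mul1r mulrDr divff ?gt_eqF //; lra.
    by rewrite ler_wpM2l ?normc_ge0 // le_max lexx orbT.
have : normc (g z) <= r^-1.
  apply: (removable_max r0 r1) => //; rewrite ?invr_ge0 ?(ltW r0) ?z0 //.
  move=> x xr; rewrite -[r^-1]mul1r ler_pdivlMr // -xr; apply: g1.
  by rewrite /punctured xr r0.
by rewrite -[r^-1]mul1r ler_pdivlMr // leNgt rg.
Qed.

End Schwarz.

(** * Bounds for the first two coefficients of a Schwarz function *)

Section SchwarzCoef.
Variable R : realType.
Local Notation C := (R[i]).
Implicit Types (f g w : C -> C) (z c : C).

Lemma schwarz_le w (w1 : C -> C) (w2 : C -> C) : w 0 = 0 ->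
  (forall z, normc z < 1 -> cderiv w z (w1 z)) ->
  (forall z, normc z < 1 -> cderiv w1 z (w2 z)) ->
  (forall z, normc z < 1 -> normc (w z) <= 1) ->
  forall z, normc z < 1 -> normc (w z) <= normc z.
Proof.
move=> w0 dw dw1 wD z z1.
have [->|zn] := eqVneq z 0; first by rewrite w0 !normc0.
have tw : twice_cderiv (@punctured R) w.
  by exists w1 => x /andP[_ x1]; split; [exact: dw | exists (w2 x); exact: dw1].
have zp : punctured z by rewrite /punctured normc_gt0 zn.
have := @schwarz_gen R (fun x => w x * x^-1) _ _ _ z zp.
rewrite normcM normcV ler_pdivrMr ?normc_gt0 // mul1r; apply.
- apply: twice_cderivM tw (twice_cderivV _ (@twice_cderiv_id _ _)).
  by move=> x /andP[]; rewrite normc_gt0.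
- have [|d d0 dP] := @cderiv_bound R w 0 (w1 0); first by apply: dw; rewrite normc0.
  exists d, (normc (w1 0) + 1); split=> // h /andP[h0 /dP].
  by rewrite add0r w0 subr0 normcM normcV ler_pdivrMr.
- move=> x /andP[x0 x1]; rewrite normcM normcV divfK ?gt_eqF //; exact: wD.
Qed.

Lemma schwarz_coef1 w (w1 : C -> C) (w2 : C -> C) : w 0 = 0 ->
  (forall z, normc z < 1 -> cderiv w z (w1 z)) ->
  (forall z, normc z < 1 -> cderiv w1 z (w2 z)) ->
  (forall z, normc z < 1 -> normc (w z) <= 1) ->
  normc (w1 0) <= 1.
Proof.
move=> w0 dw dw1 wD; have wle := schwarz_le w0 dw dw1 wD.
apply/ler_addgt0Pr => e e0.
have d0 : cderiv w 0 (w1 0) by apply: dw; rewrite normc0.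
have /cderivP/(_ e e0)[r r0 rP] := d0.
pose t := Num.min (1 / 2) (r / 2).
have t0 : 0 < t by rewrite lt_min !divr_gt0.
have tr : t < r by rewrite gt_min; apply/orP; right; lra.
have t1 : t < 1 by rewrite gt_min; apply/orP; left; lra.
have nt : normc t%:C = t by rewrite normc_real gtr0_norm.
have := rP t%:C; rewrite nt add0r w0 subr0 => /(_ tr).
have := wle t%:C; rewrite nt => /(_ t1).
have := normcB (w t%:C) (w t%:C - w1 0 * t%:C).
rewrite opprB addrCA subrr addr0 normcM nt => h1 h2 h3.
have : normc (w1 0) * t <= (1 + e) * t by move: h1 h2 h3; lra.
by rewrite ler_pM2r.
Qed.

(** The squares of the two sides differ by (1 - |c|^2) (1 - |v|^2). *)
Lemma blaschke_le c v : normc c < 1 -> normc v <= 1 ->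
  normc (v - c) <= normc (1 - c^* * v).
Proof.
move=> c1 v1; rewrite -(@ler_pXn2r R 2) ?nnegrE ?normc_ge0 //.
have c2 : normc c ^+ 2 <= 1 by rewrite exprn_ile1 ?normc_ge0 // ltW.
have v2 : normc v ^+ 2 <= 1 by rewrite exprn_ile1 ?normc_ge0.
rewrite -subr_ge0 (_ : _ - _ = (1 - normc c ^+ 2) * (1 - normc v ^+ 2)).
  by rewrite mulr_ge0 ?subr_ge0.
rewrite !normc_sqr; case: c v {c1 v1 c2 v2} => a b [p q].
by rewrite !(ReD, ImD, ReN, ImN, ReM, ImM) /=; ring.
Qed.

(** With v = w / z = c + c_2 z + o(z), the quotient of v - c by (1 - conj(c) v) z is bounded by 1
    through [schwarz_gen], and its limit at 0 is c_2 / (1 - |c|^2). The condition |c| < 1 keeps 1 -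
    conj(c) v away from 0. *)
Lemma schwarz_coef2_lt w (w1 : C -> C) (w2 : C -> C) : w 0 = 0 ->
  (forall z, normc z < 1 -> cderiv w z (w1 z)) ->
  (forall z, normc z < 1 -> cderiv w1 z (w2 z)) ->
  (forall z, normc z < 1 -> normc (w z) <= 1) ->
  normc (w1 0) < 1 -> normc (w2 0 / 2) <= 1 - normc (w1 0) ^+ 2.
Proof.
move=> w0 dw dw1 wD c_lt1; set c := w1 0 in c_lt1 *; set c2 := w2 0 / 2.
have wle := schwarz_le w0 dw dw1 wD.
have tw : twice_cderiv (@punctured R) w.
  by exists w1 => x /andP[_ x1]; split; [exact: dw | exists (w2 x); exact: dw1].
have p0 x : punctured x -> x != 0 by move=> /andP[]; rewrite normc_gt0.
pose v x := w x * x^-1.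
have v1 x : punctured x -> normc (v x) <= 1.
  move=> xp; rewrite normcM normcV ler_pdivrMr ?normc_gt0 ?p0 // mul1r.
  by apply: wle; case/andP: xp.
have tv : twice_cderiv (@punctured R) v.
  rewrite /v; apply: (twice_cderivM tw).
  apply: twice_cderivV _ (@twice_cderiv_id _ _); exact: p0.
have den x : punctured x -> 1 - normc c <= normc (1 - c^* * v x).
  move=> /v1 vx; have := normcD (1 - c^* * v x) (c^* * v x).
  rewrite subrK normc1 normcM normc_conjc.
  have : normc c * normc (v x) <= normc c by rewrite ler_piMr ?normc_ge0.
  lra.
have den0 x : punctured x -> 1 - c^* * v x != 0.
  by move=> /den xd; rewrite -normc_gt0; apply: lt_le_trans xd; rewrite subr_gt0.
have tay (e : R) : 0 < e -> exists2 s : R, 0 < s & forall h, 0 < normc h < s ->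
    normc (v h - c - c2 * h) <= e * normc h.
  move=> e0; have [||s s0 sP] := @cderiv_taylor2 R w w1 0 (w2 0) 1 ltr01 _ _ e e0.
  - by move=> h h1; rewrite add0r; apply: dw.
  - by apply: dw1; rewrite normc0.
  exists s => // h /andP[h0 /sP]; rewrite add0r w0 subr0 -/c -/c2.
  have hn : h != 0 by rewrite -normc_gt0.
  rewrite (_ : w h - _ - _ = (v h - c - c2 * h) * h); last by rewrite /v; field.
  by rewrite normcM expr2 mulrA ler_pM2r.
have v2le : forall x, punctured x -> normc ((v x - c) * ((1 - c^* * v x) * x)^-1) <= 1.
  apply: schwarz_gen.
  - apply: twice_cderivM; first exact: twice_cderivB tv (twice_cderiv_cst _ _).
    apply: twice_cderivV => [x xp|]; first by rewrite mulf_neq0 ?den0 ?p0.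
    apply: twice_cderivM (@twice_cderiv_id _ _).
    apply: twice_cderivB (twice_cderiv_cst _ _) _.
    exact: twice_cderivM (twice_cderiv_cst _ _) tv.
  (* Boundedness at the puncture: the numerator is at most (|c_2| + 1) |h|, and |1 - conj(c) v| is
     at least 1 - |c|. *)
  - have [s s0 sP] := tay 1 ltr01.
    exists (Num.min s 1), ((normc c2 + 1) / (1 - normc c)); split.
      by rewrite lt_min s0 ltr01.
    move=> h; rewrite lt_min => /and3P[h0 hs h1].
    have hp : punctured h by rewrite /punctured h0.
    have := sP h; rewrite h0 hs mul1r => /(_ isT) H.
    have {}H : normc (v h - c) <= (normc c2 + 1) * normc h.
      by have := normcD (v h - c - c2 * h) (c2 * h); rewrite subrK normcM; move: H; lra.
    rewrite normcM normcV normcM ler_pdivrMr ?mulr_gt0 //; last first.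
      by rewrite normc_gt0 den0.
    apply: le_trans H _; rewrite mulrA ler_wpM2r ?normc_ge0 //.
    rewrite mulrAC ler_pdivlMr ?subr_gt0 // ler_wpM2l ?den //.
    by rewrite addr_ge0 ?normc_ge0.
  - move=> x xp; have [x0 x1] := andP xp.
    rewrite normcM normcV normcM invfM mulrA divfK ?gt_eqF //.
    rewrite ler_pdivrMr ?mul1r ?normc_gt0 ?den0 //.
    by apply: blaschke_le => //; apply: v1.
have key x : punctured x -> normc (v x - c) <= normc (1 - c^* * v x) * normc x.
  move=> xp; have := v2le x xp; have [x0 x1] := andP xp.
  by rewrite normcM normcV normcM ler_pdivrMr ?mul1r // mulr_gt0 // normc_gt0 den0.
apply/ler_addgt0Pr => e e0.
(* One half of e absorbs the Taylor error of v, the other the deviation of 1 - conj(c) v from 1 -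
   |c|^2. *)
pose e' := e / 2; have e'0 : 0 < e' by rewrite divr_gt0.
have [s s0 sP] := tay e' e'0.
have K0 : 0 < normc c2 + e' by rewrite ltr_wpDl ?normc_ge0.
have [t t0 [t1 ts tK]] : exists2 t : R, 0 < t & [/\ t < 1, t < s & (normc c2 + e') * t <= e'].
  exists (Num.min (1 / 2) (Num.min (s / 2) (e' / (normc c2 + e')))).
    by rewrite !lt_min !divr_gt0.
  split.
  - by rewrite gt_min; apply/orP; left; lra.
  - by rewrite !gt_min; apply/orP; right; apply/orP; left; lra.
  - by rewrite -ler_pdivlMl // [leRHS]mulrC !ge_min lexx !orbT.
pose h : C := t%:C.
have nt : normc h = t by rewrite normc_real gtr0_norm.
have hp : punctured h by rewrite /punctured nt t0.
have H1 := key h hp; have H2 := sP h; rewrite nt t0 ts in H1 H2.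
have {}H2 := H2 isT.
have H3 : normc (v h - c) <= (normc c2 + e') * t.
  by have := normcD (v h - c - c2 * h) (c2 * h); rewrite subrK normcM nt; move: H2; lra.
have H4 : normc (1 - c^* * v h) <= 1 - normc c ^+ 2 + e'.
  rewrite (_ : 1 - _ = (1 - (normc c ^+ 2)%:C) - c^* * (v h - c)); last first.
    by rewrite -conjc_normc; ring.
  apply: le_trans (normcB _ _) _; rewrite normcM normc_conjc; apply: lerD.
    rewrite -[1]/(1%:C) -rmorphB normc_real ger0_norm // subr_ge0.
    by rewrite exprn_ile1 ?normc_ge0 // ltW.
  apply: le_trans tK; apply: le_trans H3.
  by rewrite ler_piMl ?normc_ge0 // ltW.
have H5 := normcB (v h - c) (v h - c - c2 * h).
rewrite opprB addrCA subrr addr0 normcM nt in H5.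
have : normc c2 * t <= (1 - normc c ^+ 2 + e) * t.
  have : normc (1 - c^* * v h) * t <= (1 - normc c ^+ 2 + e') * t.
    by rewrite ler_wpM2r // ltW.
  move: H1 H2 H5; rewrite /e'; lra.
by rewrite ler_pM2r.
Qed.

Lemma schwarz_coef2 w (w1 : C -> C) (w2 : C -> C) : w 0 = 0 ->
  (forall z, normc z < 1 -> cderiv w z (w1 z)) ->
  (forall z, normc z < 1 -> cderiv w1 z (w2 z)) ->
  (forall z, normc z < 1 -> normc (w z) <= 1) ->
  normc (w2 0 / 2) <= 1 - normc (w1 0) ^+ 2.
Proof.
move=> w0 dw dw1 wD; have c1 := schwarz_coef1 w0 dw dw1 wD.
set c := w1 0 in c1 *; set c2 := w2 0 / 2.
apply/ler_addgt0Pr => e e0.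
have K0 : 0 < normc c2 + 2 by rewrite ltr_wpDl ?normc_ge0.
have [s s0 [s1 sK]] : exists2 s : R, 0 < s & s < 1 /\ s * (normc c2 + 2) <= e.
  exists (Num.min (1 / 2) (e / (normc c2 + 2))); first by rewrite lt_min !divr_gt0.
  split; first by rewrite gt_min; apply/orP; left; lra.
  by rewrite -ler_pdivlMr // ge_min lexx orbT.
pose q : C := (1 - s)%:C.
have nq : normc q = 1 - s by rewrite normc_real gtr0_norm // subr_gt0.
have scl f (d : C) z : cderiv f z d -> cderiv (fun x => q * f x) z (q * d).
  by move=> df; apply: cderiv_eq (cderivM (cderiv_cst q z) df) _; rewrite mulr0 addr0.
(* Scaling [w] by [q < 1] reduces to the case [|w'(0)| < 1]. *)
have H := @schwarz_coef2_lt (fun x => q * w x) (fun x => q * w1 x) (fun x => q * w2 x).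
rewrite w0 mulr0 -mulrA !normcM -/c nq in H.
have {}H : (1 - s) * normc c2 <= 1 - ((1 - s) * normc c) ^+ 2.
  apply: le_trans (H erefl _ _ _ _).
  - by rewrite /c2 normcM.
  - by move=> z z1; apply/scl/dw.
  - by move=> z z1; apply/scl/dw1.
  - by move=> z z1; rewrite normcM nq mulr_ile1 ?normc_ge0 ?wD // ?subr_ge0 ?gerBl ltW.
  - apply: le_lt_trans (_ : (1 - s) * 1 < 1); last by rewrite mulr1 gtrBl.
    by rewrite ler_wpM2l // subr_ge0 ltW.
have : normc c ^+ 2 <= 1 by rewrite exprn_ile1 ?normc_ge0.
have := sqr_ge0 (normc c); move: H sK; rewrite exprMn.
set x := normc c ^+ 2; set y := normc c2 => H sK x0 x1.
have : s * x <= s * 1 by rewrite ler_wpM2l // ltW.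
have : 0 <= s * s * x by rewrite mulr_ge0 // mulr_ge0 // ltW.
move: H sK; rewrite expr2; lra.
Qed.

End SchwarzCoef.

(** * From the class to Schwarz functions, and the extremal functions *)

Section BoundedTurning.
Variable R : realType.
Local Notation C := (R[i]).
Implicit Types (f g w : C -> C) (a b : nat -> C) (z c : C).

Lemma cderiv_eqD f g z (d : C) : (forall x, normc x < 1 -> f x = g x) ->
  normc z < 1 -> cderiv f z d -> cderiv g z d.
Proof.
move=> fg z1; apply: (@cderiv_near _ _ _ _ _ (1 - normc z)); first by rewrite subr_gt0.
by move=> h hz; apply: fg; have := normcD z h; lra.
Qed.

Lemma classS_series f a : classS f a -> rad_ge1 a /\
  forall z, normc z < 1 -> cderiv f z (ps (dseq a) z).
Proof.
move=> [_ fs _ _ _].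
have cv z : normc z < 1 -> pseries a z n @[n --> \oo] --> (f z : C^o).
  by move=> z1; apply/fs/inDE.
have ra : rad_ge1 a by apply: pseries_rad_ge1 => z z1; exists (f z); apply: cv.
split=> // z z1; apply: (@cderiv_eqD (ps a)) (ps_cderiv ra z1) => // x x1.
by apply: pseries_unique => //; apply: cv.
Qed.

(** The two values come from matching f' = 1 + 2 a_2 z + 3 a_3 z^2 + ... with B(w), where B = 1 +
    z/2 - z^2/8 + .... The proof reads them off w' = p1 / q and its derivative, using q(0) = 1/2 and
    q'(0) = -a_2. *)
Lemma classBT_schwarz f a : classBT f a -> exists w w1 w2 : C -> C,
  [/\ w 0 = 0, forall z, normc z < 1 -> cderiv w z (w1 z),
      forall z, normc z < 1 -> cderiv w1 z (w2 z),
      forall z, normc z < 1 -> normc (w z) <= 1 &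
      w1 0 = 4 * a 2%N /\ w2 0 / 2 = 6 * a 3%N + 4 * a 2%N ^+ 2].
Proof.
move=> [fS [w [dw w0 wD fw]]].
have [ra df] := classS_series fS.
have a1 : a 1%N = 1 by case: fS => _ _ [].
have [b [b0 b1 dB BE B2]] := Bfun_series R.
have r1 := rad_ge1_dseq ra; have r2 := rad_ge1_dseq r1.
pose p := ps (dseq a); pose p1 := ps (dseq (dseq a)); pose p2 := ps (dseq (dseq (dseq a))).
have wD' z : normc z < 1 -> normc (w z) < 1 by move=> /inDE/wD/inDE.
have pE z : normc z < 1 -> p z = ps b (w z).
  move=> z1; rewrite /p -(derive1_cderiv (df z z1)) fw; last exact/inDE.
  by case: (BE _ (wD' z z1)).
have p_neq0 z : normc z < 1 -> p z != 0.
  move=> z1; rewrite pE //; have [_] := BE _ (wD' z z1).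
  by apply: contraTneq => ->; rewrite ltxx.
pose q z := p z - p z ^+ 3 / 2.
have q_neq0 z : normc z < 1 -> q z != 0.
  move=> z1; rewrite /q (_ : _ - _ = p z * (2 - p z ^+ 2) / 2); last by field.
  rewrite !mulf_neq0 ?p_neq0 ?invr_eq0 ?pnatr_eq0 // subr_eq0 eq_sym pE //.
  by apply: B2; apply: wD'.
have dp z : normc z < 1 -> cderiv p z (p1 z) := @ps_cderiv R _ z r1.
have dp1 z : normc z < 1 -> cderiv p1 z (p2 z) := @ps_cderiv R _ z r2.
pose w1 z := p1 z * (q z)^-1.
have dw1 z : normc z < 1 -> cderiv w z (w1 z).
  move=> z1; have dwz : cderiv w z (derive1 (w : C^o -> C^o) z).
    by apply/cderiv_derivable/dw/inDE.
  apply: (cderiv_eq dwz).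
  (* The chain rule gives p1 = q w' from the mere existence of w'; division by q then exhibits w' as
     a differentiable function. *)
  have dc := cderiv_comp dwz (dB _ (wD' z z1)).
  have {}dc : cderiv p z (q z * derive1 (w : C^o -> C^o) z).
    have -> : q z = ps b (w z) - ps b (w z) ^+ 3 / 2 by rewrite /q pE.
    exact: (@cderiv_eqD (fun x => ps b (w x)) p z _ (fun x x1 => esym (pE x x1)) z1 dc).
  by rewrite /w1 (cderiv_unique (dp z z1) dc) mulrC mulKf ?q_neq0.
pose q1 z := p1 z - (p z * p z * p1 z + p z * (p z * p1 z + p z * p1 z)) / 2.
have dq z : normc z < 1 -> cderiv q z (q1 z).
  move=> z1; have dpz := dp z z1.
  apply: cderiv_eq.
    apply: (cderivB dpz); apply: cderivM (cderiv_cst _ _).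
    exact: (cderivM dpz (cderivM dpz dpz)).
  by rewrite /q1; ring.
exists w, w1, (fun z => p1 z * (- q1 z / q z ^+ 2) + (q z)^-1 * p2 z); split=> //.
- move=> z z1; apply: cderivM; first exact: dp1.
  by apply: cderivV (dq z z1); apply: q_neq0.
- by move=> z z1; apply/ltW/wD'.
have p0 : p 0 = 1 by rewrite /p ps0 // /dseq a1 mulr1.
have p10 : p1 0 = 2 * a 2%N by rewrite /p1 ps0 // /dseq; ring.
have p20 : p2 0 = 6 * a 3%N.
  rewrite /p2 (ps0 (rad_ge1_dseq r2)) /dseq; ring.
have q0 : q 0 = 2^-1 by rewrite /q p0 expr1n; field.
have q10 : q1 0 = - a 2%N by rewrite /q1 p0 p10; field.
rewrite /w1 q10 q0 p10 p20; split; first by rewrite invrK; ring.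
by field.
Qed.

Lemma normc_le_frac z (x : R) (y : C) : y = x%:C -> (`|z| <= y) = (normc z <= x).
Proof. by move=> ->; rewrite normrc lecR. Qed.

Lemma classBT_Gamma f a : classBT f a ->
  `|Gamma1 a| <= 1 / 8 /\ `|Gamma2 a| <= 1 / 12.
Proof.
move=> /classBT_schwarz[w [w1 [w2 [w0 dw dw1 wD [c1E c2E]]]]].
have := schwarz_coef1 w0 dw dw1 wD; have := schwarz_coef2 w0 dw dw1 wD.
rewrite c2E; set c1 := w1 0 in c1E *; set c2 := 6 * _ + _ => h2 h1.
have a2 : a 2%N = c1 / 4 by rewrite c1E; field.
have a3 : a 3%N = (c2 - c1 ^+ 2 / 4) / 6 by rewrite /c2 c1E; field.
rewrite (@normc_le_frac _ (1 / 8)); last by rewrite fmorph_div rmorph1 rmorph_nat.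
rewrite (@normc_le_frac _ (1 / 12)); last by rewrite fmorph_div rmorph1 rmorph_nat.
split.
  rewrite /Gamma1 a2 (_ : _ / 2 = - c1 / 8); last by field.
  by rewrite normcM normc_opp normcV normc_nat ler_wpM2r ?invr_ge0.
rewrite /Gamma2 a2 a3 [X in normc X](_ : _ = (13 * c1 ^+ 2 / 16 - c2) / 12); last by field.
rewrite normcM normcV normc_nat ler_wpM2r ?invr_ge0 //.
apply: le_trans (normcB _ _) _.
rewrite (_ : 13 * c1 ^+ 2 / 16 = 13 / 16 * c1 ^+ 2); last by field.
rewrite normcM normcX normcM normcV !normc_nat.
have : normc c1 ^+ 2 <= 1 by rewrite exprn_ile1 ?normc_ge0.
have := sqr_ge0 (normc c1); move: h2; lra.
Qed.

(** The constant of integration is 0, in accordance with f(0) = 0. *)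
Definition prim b n : C := if n is m.+1 then b m / m.+1%:R else 0.

Lemma dseq_prim b : dseq (prim b) = b.
Proof. by apply/funext => n; rewrite /dseq /= mulrCA divff ?mulr1 // pnatr_eq0. Qed.

Lemma rad_ge1_prim b : rad_ge1 b -> rad_ge1 (prim b).
Proof.
move=> rb q q01; have [K KP] := rb q q01; exists K => -[|n]; rewrite [prim _ _]/prim.
  by rewrite normc0 mul0r; apply: le_trans (KP 0%N); rewrite mulr_ge0 ?normc_ge0.
apply: le_trans (KP n); move/andP: q01 => [q0 q1].
rewrite normcM normcV normc_nat exprS; have := normc_ge0 (b n).
have : 0 <= q ^+ n by rewrite exprn_ge0.
set x := q ^+ n; set y := normc (b n) => x0 y0.
have i0 : (0 : R) <= n.+1%:R^-1 by rewrite invr_ge0.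
have i1 : (n.+1%:R^-1 : R) <= 1 by rewrite invf_le1 ?ler1n ?ltr0n.
apply: ler_pM; rewrite ?mulr_ge0 //; first by rewrite ler_piMr.
by rewrite ler_piMl // ltW.
Qed.

Lemma Re_scale z (x : R) : complex.Re (z * x%:C) = complex.Re z * x.
Proof. by case: z => p q /=; rewrite mulr0 subr0. Qed.

(* Noshiro-Warschawski: by the mean value theorem, [Re ((f z2 - f z1) / (z2 - z1))] is
   a value of [Re f'], so [f] is injective. *)
Lemma Re_gt0_classS b : rad_ge1 b -> b 0%N = 1 ->
  (forall z, normc z < 1 -> 0 < complex.Re (ps b z)) -> classS (ps (prim b)) (prim b) /\
  forall z, normc z < 1 -> cderiv (ps (prim b)) z (ps b z).
Proof.
move=> rb b0 Re0; have rp := rad_ge1_prim rb.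
have df z : normc z < 1 -> cderiv (ps (prim b)) z (ps b z).
  by move=> z1; have := ps_cderiv rp z1; rewrite dseq_prim.
split; last exact: df.
split.
- by move=> z /inDE/df[].
- by move=> z /inDE z1; apply: pseries_cvg.
- by rewrite /= b0 divr1.
- split; first by rewrite ps0.
  by rewrite (derive1_cderiv (df 0 _)) ?normc0 ?ltr01 // ps0.
move=> z1 z2 /inDE n1 /inDE n2 E; apply/eqP/negPn/negP => zn.
pose v := z2 - z1; have zv : z1 + v = z2 by rewrite /v addrC subrK.
have v1 : normc (z1 + v) < 1 by rewrite zv.
have seg (t : R) (t01 : 0 <= t <= 1) := normc_segment t01 n1 v1.
(* The weight conj(v) turns f' v into |v|^2 f', whose real part can vanish only for v = 0. *)
have [t /seg t1] := cderiv_MVT v^* (fun t t01 => df _ (seg t t01)).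
rewrite zv E subrr mulr0 mulrCA conjc_normc Re_scale => /esym/eqP.
rewrite mulf_eq0 (gt_eqF (Re0 _ t1)) sqrf_eq0 normc_eq0 subr_eq0 /=.
by rewrite eq_sym (negPf zn).
Qed.

Definition sqr_subst b n : C := if odd n then 0 else b n./2.

Lemma pseries_sqr_subst b z n :
  pseries (sqr_subst b) z n.*2 = pseries b (z ^+ 2) n.
Proof.
rewrite !pseriesE; elim: n => [|n IH]; first by rewrite !big_ord0.
rewrite doubleS !big_ord_recr /= IH /sqr_subst /= odd_double doubleK mul0r addr0.
by rewrite -exprM mul2n.
Qed.

(** Partial sums of [b] at z^2 are the even-indexed partial sums at z; these suffice, as the full
    series converges by its bounded coefficients. *)
Lemma ps_sqr_subst b z : (forall n, normc (b n) <= 1) -> normc z < 1 ->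
  ps (sqr_subst b) z = ps b (z ^+ 2).
Proof.
move=> b1 z1.
have z21 : normc (z ^+ 2) < 1 by rewrite normcX exprn_ilt1 ?normc_ge0.
have rs : rad_ge1 (sqr_subst b).
  by apply: (@rad_ge1_bounded _ _ 1) => n; rewrite /sqr_subst; case: ifP; rewrite ?normc0.
apply/esym/pseries_unique => //; first exact: rad_ge1_bounded.
have /cvg_normcP H := pseries_cvg rs z1.
apply/cvg_normcP => e /H[N NP]; exists N => n Nn.
by rewrite -pseries_sqr_subst; apply: NP; apply: leq_trans Nn _; rewrite -addnn leq_addr.
Qed.

Lemma norm_frac z n : z = - (n%:R)^-1 -> `|z| = 1 / n%:R.
Proof.
move=> ->; rewrite normrc normc_opp normcV normc_nat div1r.
by rewrite fmorphV rmorph_nat.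
Qed.

End BoundedTurning.

Theorem theorem4p1 (R : realType) :
  (forall (f : R[i]^o -> R[i]^o) (a : nat -> R[i]),
      classBT f a ->
      `|Gamma1 a| <= 1 / 8 /\ `|Gamma2 a| <= 1 / 12)
  /\ (exists (f1 : R[i]^o -> R[i]^o) (a : nat -> R[i]),
        [/\ classBT f1 a,
            (forall z : R[i], inD z -> derive1 f1 z = Bfun z)
          & `|Gamma1 a| = 1 / 8])
  /\ (exists (f2 : R[i]^o -> R[i]^o) (a : nat -> R[i]),
        [/\ classBT f2 a,
            (forall z : R[i], inD z -> derive1 f2 z = Bfun (z ^+ 2))
          & `|Gamma2 a| = 1 / 12]).
Proof.
split; first exact: classBT_Gamma.
have [b [b0 b1 dB BE _]] := Bfun_series R; have rb := rad_ge1_bounded b1.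
have n0 : normc (0 : R[i]) < 1 by rewrite normc0.
(* This is B' = B - B^3/2 at 0, where B = 1. *)
have b1E : b 1%N = 2^-1.
  have := cderiv_unique (ps_cderiv rb n0) (dB 0 n0).
  rewrite (ps0 (rad_ge1_dseq rb)) (ps0 rb) b0 => E.
  have -> : b 1%N = dseq b 0 by rewrite /dseq; ring.
  by rewrite E; field.
split.
  have [|S1 d1] := Re_gt0_classS rb b0; first by move=> z /BE[].
  have dE (z : R[i]) : inD z -> derive1 (ps (prim b) : R[i]^o -> R[i]^o) z = Bfun z.
    by move=> /inDE z1; rewrite (derive1_cderiv (d1 z z1)); case: (BE z z1).
  (* The Schwarz function is the identity, so a_2 = 1/4 and Gamma_1 = -1/8. *)
  exists (ps (prim b)), (prim b); split=> //.
    split=> //; exists id; split=> // z _; exact: derivable_id.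
  by apply: norm_frac; rewrite /Gamma1 /= b1E; field.
have sq (z : R[i]) : normc z < 1 -> normc (z ^+ 2) < 1.
  by move=> z1; rewrite normcX exprn_ilt1 ?normc_ge0.
have rs : rad_ge1 (sqr_subst b).
  by apply: (@rad_ge1_bounded _ _ 1) => n; rewrite /sqr_subst; case: ifP; rewrite ?normc0.
have [||S1 d1] := Re_gt0_classS rs; first by [].
  by move=> z z1; rewrite ps_sqr_subst //; case: (BE _ (sq z z1)).
have dE (z : R[i]) : inD z ->
    derive1 (ps (prim (sqr_subst b)) : R[i]^o -> R[i]^o) z = Bfun (z ^+ 2).
  move=> /inDE z1; rewrite (derive1_cderiv (d1 z z1)) ps_sqr_subst //.
  by case: (BE _ (sq z z1)).
(* The Schwarz function is z^2, so a_2 = 0, a_3 = 1/6 and Gamma_2 = -1/12. *)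
exists (ps (prim (sqr_subst b))), (prim (sqr_subst b)); split=> //.
  split=> //; exists (fun z => z ^+ 2); split; last exact: dE.
  - by move=> z _; case: (cderivM (cderiv_id z) (cderiv_id z)).
  - by rewrite expr0n.
  - by move=> z /inDE/sq/inDE.
by apply: norm_frac; rewrite /Gamma2 /= /sqr_subst /= b1E; field.
Qed.
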